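(* Let $q_\phi$ be any regular OrderSPN over $(\sigma,G)$ on $d$ variables, and let $p$ be any order-modular distribution with unnormalized form $\tilde p(\sigma,G)=\prod_{i=1}^d p_{G_i}(G_i)\,\mathbf{1}_{G\models\sigma}$. Then the evidence lower bound $$\mathbb{E}_{q_\phi(\sigma,G)}[\log\tilde p(\sigma,G)]+H(q_\phi(\sigma,G)),\qquad H(q_\phi(\sigma,G))=-\mathbb{E}_{q_\phi(\sigma,G)}[\log q_\phi(\sigma,G)],$$ and its gradient with respect to the parameters (sum-node weights) $\phi$ can be computed in time linear in the size (number of edges) of the SPN.
   Context: Fix $d\ge2$. An order $\sigma$ is a permutation (linear ordering) of $\{1,\dots,d\}$; $\sigma^{<i}$ is the set of elements preceding $i$. For $S\subseteq\{1,\dots,d\}$, $\sigma_S$ denotes a linear ordering of $S$ and $G_S=(G_i)_{i\in S}$ a tuple of parent sets; a directed graph $G$ is the tuple $(G_1,\dots,G_d)$. $G\models\sigma$ means $G_i\subseteq\sigma^{<i}$ for all $i$. Order-modular means $p(\sigma,G)\propto\prod_i p_{G_i}(G_i)\mathbf{1}_{G_i\subseteq\sigma^{<i}}$ for nonnegative functions $p_{G_i}$ on parent sets. A sum-product network (SPN) is a rooted DAG of leaf, product and sum nodes, each node representing a probability distribution over the variables in its scope. Leaves carry given distributions; a product node is the product of its children's distributions; a sum node $T$ is $\sum_i\phi_{T,i}C_i$ over its children, with weights $\phi_{T,i}>0$, $\sum_i\phi_{T,i}=1$. An OrderSPN $q_\phi$ is an SPN over $(\sigma,G)$ whose root is associated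 with $(\emptyset,\{1,\dots,d\})$ and such that: (1) Each leaf is associated with $(S_1,\{i\})$, $i\notin S_1$, has scope $(\sigma_{\{i\}},G_i)$, and its distribution has support only on $G_i\subseteq S_1$. (2) Each sum node is associated with disjoint $(S_1,S_2)$, $|S_2|>1$, has scope $(\sigma_{S_2},G_{S_2})$, and its $i$-th child is a product node associated with $(S_1,S_{21,i},S_{22,i})$ for some partition $(S_{21,i},S_{22,i})$ of $S_2$. (3) Each product node is associated with disjoint $(S_1,S_{21},S_{22})$, has scope $(\sigma_{S_{21}\cup S_{22}},G_{S_{21}\cup S_{22}})$ with the ordering being the concatenation $(\sigma_{S_{21}},\sigma_{S_{22}})$ (other orderings have probability $0$), and has two children (sum nodes or leaves), the first associated with $(S_1,S_{21})$ and the second with $(S_1\cup S_{21},S_{22})$. It is regular if it is organized in alternating sum and product layers starting from the root sum node, every sum node in the $j$-th sum layer has the same number $K_j$ of children, and for each sum node with set $S_2$ all children satisfy $|S_{21,i}|=\lfloor|S_2|/2\rfloor$, $|S_{22,i}|=\lceil|S_2|/2\rceil$, with the ordered pairs $(S_{21,i},S_{22,i})$ distinct for different children. Time is counted in elementary real operations (arithmetic and logarithm). The leaf distributions do not depend on $\phi$; for each leaf $L$, a distribution over the parents $G_i$ of a variable $i$, the leaf quantity $\mathbb{E}_L[\log p_{G_i}(G_i)]+H(L)$ is finite and available in $O(1)$ time. (In the paper the leaf associated with $(S_1,\{i\})$ is $L(G_i)\propto p_{G_i}(G_i)\mathbf{1}_{G_i\subseteq S_1}$, for which this quantity is a precomputed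 constant $\log\sum_{G_i\subseteq S_1}p_{G_i}(G_i)$.) *)

(* Defs.v *)
(* MathComp + MathComp-Analysis *)
From HB Require Import structures.
From mathcomp Require Import all_boot all_order all_fingroup all_algebra.
From mathcomp Require Import all_classical all_reals all_analysis.

Set Implicit Arguments.
Unset Strict Implicit.
Unset Printing Implicit Defensive.

Import Order.TTheory GRing.Theory Num.Theory.
Import numFieldNormedType.Exports.

Local Open Scope ring_scope.

Section FiniteDistributions.
Variables (R : realType) (T : finType).

Definition is_dist (q : T -> R) : Prop :=
  (forall x, 0 <= q x) /\ \sum_x q x = 1.

(* Values in \bar R, so that log 0 = -oo; in \bar R, 0 * -oo = 0. *)
Definition mean (q : T -> R) (f : T -> \bar R) : \bar R :=
  (\sum_x (q x)%:E * f x)%E.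

Definition entropy (q : T -> R) : \bar R :=
  (- mean q (fun x => lne (q x)%:E))%E.

End FiniteDistributions.

Section Orders.
Variable d : nat.

(* A permutation s lists the variables in the order s 0, s 1, ... *)
Definition digraph := {ffun 'I_d -> {set 'I_d}}.

Definition before (s : {perm 'I_d}) (i : 'I_d) : {set 'I_d} :=
  [set j | ((s^-1)%g j < (s^-1)%g i)%N].

Definition models (G : digraph) (s : {perm 'I_d}) : bool :=
  [forall i, G i \subset before s i].

Variable R : realType.

Definition ptilde (pG : 'I_d -> {set 'I_d} -> R)
    (x : {perm 'I_d} * digraph) : R :=
  (\prod_(i < d) pG i (x.2 i)) * (models x.2 x.1)%:R.

Definition order_modular (pG : 'I_d -> {set 'I_d} -> R)
    (p : {perm 'I_d} * digraph -> R) : Prop :=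
  [/\ is_dist p,
      forall i A, 0 <= pG i A &
      exists2 c : R, 0 < c & forall x, p x = c * ptilde pG x].

End Orders.

(* The sets with which a node is associated: (S1, {i}) for a leaf, (S1, S2) for
   a sum node, (S1, S21, S22) for a product node. *)
Inductive label (d : nat) : Type :=
| Leaf of {set 'I_d} & 'I_d
| Sum of {set 'I_d} & {set 'I_d}
| Prod of {set 'I_d} & {set 'I_d} & {set 'I_d}.

Record spn (d : nat) := Spn {
  node : finType;
  root : node;
  lab : node -> label d;
  children : node -> seq node }.

Section OrderSPN.
Variables (d : nat) (N : spn d).
Implicit Types v c : node N.

Definition edge : rel (node N) := fun v c => c \in children v.

Definition is_leaf v : bool := if lab v is Leaf _ _ then true else false.
Definition is_sum v : bool := if lab v is Sum _ _ then true else false.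

Definition spn_size : nat := \sum_(v : node N) size (children v).

Definition rooted_dag : Prop :=
  (forall v, connect edge (root N) v) /\
  (forall v c, edge v c -> ~~ connect edge c v).

Definition assoc v : option ({set 'I_d} * {set 'I_d}) :=
  match lab v with
  | Leaf S1 i => Some (S1, [set i])
  | Sum S1 S2 => Some (S1, S2)
  | Prod _ _ _ => None
  end.

Definition local_wf v : Prop :=
  match lab v with
  | Leaf S1 i => i \notin S1 /\ children v = [::]
  | Sum S1 S2 =>
      [/\ [disjoint S1 & S2], (1 < #|S2|)%N, children v <> [::] &
        forall c, edge v c -> exists S21 S22,
          [/\ lab c = Prod S1 S21 S22, S21 :|: S22 = S2,
              [disjoint S21 & S22], S21 != finset.set0 & S22 != finset.set0]]
  | Prod S1 S21 S22 =>
      [/\ [disjoint S1 & S21 :|: S22], [disjoint S21 & S22] &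
        exists c1 c2,
          [/\ children v = [:: c1; c2], assoc c1 = Some (S1, S21) &
              assoc c2 = Some (S1 :|: S21, S22)]]
  end.

Definition order_spn : Prop :=
  [/\ rooted_dag, assoc (root N) = Some (finset.set0, [set: 'I_d]) &
      forall v, local_wf v].

Definition parts v : {set 'I_d} * {set 'I_d} :=
  if lab v is Prod _ S21 S22 then (S21, S22) else (finset.set0, finset.set0).

(* The sum layers are those of even depth: children of sum nodes are product
   nodes, and children of product nodes are sum nodes or leaves. *)
Definition layered : Prop :=
  exists (layer : node N -> nat) (K : nat -> nat),
    [/\ is_sum (root N), layer (root N) = 0%N,
        forall v c, edge v c -> layer c = (layer v).+1 &
        forall j v, is_sum v -> layer v = j.*2 -> size (children v) = K j].

Definition balanced_splits : Prop :=
  forall v S1 S2, lab v = Sum S1 S2 ->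
    (forall c, edge v c ->
       #|(parts c).1| = #|S2|./2 /\ #|(parts c).2| = uphalf #|S2|) /\
    uniq [seq parts c | c <- children v].

Definition regular_order_spn : Prop :=
  [/\ order_spn, layered & balanced_splits].

(* Index set of the weights: a sum node together with the rank of a child. *)
Definition arity v : nat := if is_sum v then size (children v) else 0%N.

Definition param : finType := {v : node N & 'I_(arity v)}.

Variable R : realType.

(* phi is a row vector, so that it ranges over a normed space. *)
Definition weight (phi : 'rV[R]_#|param|) (e : param) : R :=
  phi ord0 (enum_rank e).

Definition is_weights (phi : 'rV[R]_#|param|) : Prop :=
  (forall e, 0 < weight phi e) /\
  (forall v, is_sum v ->
     \sum_(k < arity v) weight phi (existT (fun u => 'I_(arity u)) v k) = 1).

Definition leaf_dists (L : node N -> {set 'I_d} -> R) : Prop :=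
  forall v S1 i, lab v = Leaf S1 i ->
    is_dist (L v) /\ (forall A, L v A != 0 -> A \subset S1).

(* The value at (s, G) of the distribution of v, where the list s stands for an
   ordering of the scope of v; it depends on G only through the variables in
   the scope, and it is 0 when s does not list exactly the scope. *)
Fixpoint node_dist_rec (phi : 'rV[R]_#|param|) (L : node N -> {set 'I_d} -> R)
    (n : nat) v (s : seq 'I_d) (G : digraph d) : R :=
  if n is m.+1 then
    match lab v with
    | Leaf _ i => (s == [:: i])%:R * L v (G i)
    | Sum _ _ =>
        \sum_(k < arity v)
          weight phi (existT (fun u => 'I_(arity u)) v k) *
          node_dist_rec phi L m (nth v (children v) k) s G
    | Prod _ S21 _ =>
        if children v is [:: c1; c2] then
          node_dist_rec phi L m c1 (take #|S21| s) G *
          node_dist_rec phi L m c2 (drop #|S21| s) G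
        else 0
    end
  else 0.

(* A path in an acyclic graph visits at most #|node N| nodes, so the recursion
   never runs out of fuel. *)
Definition node_dist phi L v s G : R :=
  node_dist_rec phi L #|node N| v s G.

Definition spn_dist phi L (x : {perm 'I_d} * digraph d) : R :=
  node_dist phi L (root N) [seq x.1 k | k <- enum 'I_d] x.2.

(* The formula makes sense for unnormalized weights too: this is the function
   of all the weights whose partial derivatives are taken. *)
Definition elbo (pG : 'I_d -> {set 'I_d} -> R) L phi : \bar R :=
  (mean (spn_dist phi L) (fun x => lne (ptilde pG x)%:E)
   + entropy (spn_dist phi L))%E.

(* Only the values at leaves are used. *)
Definition leaf_quantity (pG : 'I_d -> {set 'I_d} -> R)
    (L : node N -> {set 'I_d} -> R) v : \bar R :=
  match lab v with
  | Leaf _ i =>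
      (mean (L v) (fun A => lne (pG i A)%:E) + entropy (L v))%E
  | _ => 0%E
  end.

End OrderSPN.

(* Straight-line programs over the reals. Every instruction takes unit time and
   appends one value to the memory; operands are addresses in the memory. *)
Inductive instr (I : Type) : Type :=
| Input of I
| Const of int
| Add of nat & nat
| Sub of nat & nat
| Mul of nat & nat
| Div of nat & nat
| Log of nat.

Definition program (I : Type) := seq (instr I).

Section Execution.
Variables (R : realType) (I : Type) (input : I -> R).

Definition operands (mem : seq R) (a b : nat) : option (R * R) :=
  if (onth mem a, onth mem b) is (Some x, Some y) then Some (x, y) else None.

(* None is failure: invalid address, division by zero, logarithm of a
   nonpositive number. *)
Definition exec (c : instr I) (mem : seq R) : option R :=
  match c with
  | Input i => Some (input i)
  | Const z => Some z%:~R
  | Add a b => omap (fun x => x.1 + x.2) (operands mem a b)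
  | Sub a b => omap (fun x => x.1 - x.2) (operands mem a b)
  | Mul a b => omap (fun x => x.1 * x.2) (operands mem a b)
  | Div a b =>
      obind (fun x => if x.2 == 0 then None else Some (x.1 / x.2))
        (operands mem a b)
  | Log a => obind (fun x => if 0 < x then Some (ln x) else None) (onth mem a)
  end.

Fixpoint run (P : program I) (mem : seq R) : option (seq R) :=
  if P is c :: P' then
    obind (fun x => run P' (rcons mem x)) (exec c mem)
  else Some mem.

End Execution.

Section Inputs.
Variables (d : nat) (N : spn d) (R : realType).

(* A program may read the weights and the leaf quantities. *)
Definition input_addr : Type := (param N + {v : node N | is_leaf v})%type.

Definition inputs (pG : 'I_d -> {set 'I_d} -> R)
    (L : node N -> {set 'I_d} -> R) (phi : 'rV[R]_#|param N|)
    (a : input_addr) : R :=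
  match a with
  | inl e => weight phi e
  | inr v => fine (leaf_quantity pG L (val v))
  end.

End Inputs.

(* Main.v *)
Require Import Defs.
From HB Require Import structures.
From mathcomp Require Import all_boot all_order all_fingroup all_algebra.
From mathcomp Require Import all_classical all_reals all_analysis.
From mathcomp Require Import ring zify.
Set Implicit Arguments.
Unset Strict Implicit.
Unset Printing Implicit Defensive.
Import Order.TTheory GRing.Theory Num.Theory.
Import numFieldNormedType.Exports.
Local Open Scope ring_scope.

(* The score of a node is E_q[log p~ - log q], for its possibly unnormalized
   distribution q and the factors of p~ in its scope; its mass is the sum of q.
   The children of a sum node split its scope into different ordered pairs with
   first parts of equal size, so their distributions have disjoint supports, and
   at a sum node log q splits as the log-weight of a child plus the log of that
   child. Score and mass thus satisfy, for all positive weights w,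
     mass = sum_k w_k mass_k,  score = sum_k (w_k score_k - w_k ln w_k mass_k)
   at a sum node and
     mass = mass_1 mass_2,  score = score_1 mass_2 + mass_1 score_2
   at a product node. At normalized weights all masses are 1, so one upward pass
   gives the scores. Differentiating the recursions gives linear equations for
   the tangents, and one downward pass computes the adjoints. Both passes spend
   boundedly many operations on every node and edge. *)

(** * Differentials and logarithmic sums *)

Section Differentials.
Variables (R : realType) (V : normedModType R).

(** The difference [g - f] vanishes near [x], so its differential there is 0. The score recursions
    hold only for positive weights; this carries differentials across identities valid only near a
    point. *)
Lemma is_diff_near (f g df : V -> R) (x : V) :
  (\forall y \near x, f y = g y) -> is_diff x f df -> is_diff x g df.
Proof.
move=> fg fdf; have fgx : f x = g x := nbhs_singleton fg.
have h0 : (g - f) \o shift x =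
    cst ((g - f) x) + (\0 : {linear V -> R}) +o_ 0 id.
  apply/eqaddoP => e e0.
  move: fg; rewrite (near_shift 0 x) subr0 => fg; near=> y.
  have fgy : f (y + x) = g (y + x) by near: y.
  rewrite /= !fctE /= fgx fgy !(subrr, addr0) normr0.
  by rewrite mulr_ge0// ltW.
have c0 : continuous (\0 : {linear V -> R}) by exact: cst_continuous.
have d0 := diff_unique c0 h0.
have id0 : is_diff x (g - f) 0.
  by apply: DiffDef => //; apply/diff_locallyP; rewrite d0.
have -> : g = f + (g - f) by rewrite addrC subrK.
by rewrite -[df]addr0; exact: is_diffD.
Unshelve. all: by end_near. Qed.

Lemma is_diff_ln (f df : V -> R) (x : V) : 0 < f x ->
  is_diff x f df -> is_diff x (fun y => ln (f y)) ((f x)^-1 *: df).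
Proof.
move=> f0 fdf; have [dln dlnE] := is_derive1_ln f0.
have lnd : is_diff (f x) (@ln R) ( *:%R^~ (f x)^-1).
  apply: DiffDef; first exact/derivable1_diffP.
  by apply/funext => h; rewrite diff1E ?derive1E ?dlnE//; exact/derivable1_diffP.
apply: is_diff_eq; apply/funext => h; rewrite /= !fctE.
by rewrite [RHS]mulrC.
Qed.

Lemma is_diff_sum (J : finType) (Q : pred J) (f df : J -> V -> R) (x : V) :
  (forall j, Q j -> is_diff x (f j) (df j)) ->
  is_diff x (fun y => \sum_(j | Q j) f j y) (fun h => \sum_(j | Q j) df j h).
Proof.
move=> fdf.
have E (F : J -> V -> R) : (fun y => \sum_(j | Q j) F j y) = \sum_(j | Q j) F j.
  by apply/funext => y; rewrite fct_sumE.
rewrite !E; elim: (index_enum J) => [|j r IH]; rewrite ?big_nil ?big_cons.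
  exact: is_diff_cst.
by case: ifP => // /fdf; move/is_diffD; exact.
Qed.

End Differentials.

Section FreeEnergy.
Variables (R : realType) (T : finType).
Implicit Types q f : T -> R.

Lemma mean_lne q f : (forall x, q x != 0 -> 0 < f x) ->
  mean q (fun x => lne (f x)%:E) = (\sum_x q x * ln (f x))%:E.
Proof.
move=> f0; rewrite /mean -sumEFin; apply: eq_bigr => x _.
have [->|/f0 fx] := eqVneq (q x) 0; first by rewrite mul0e mul0r.
by rewrite lne_EFin.
Qed.

Lemma mean_lneD_entropy q f :
  (forall x, 0 <= q x) -> (forall x, q x != 0 -> 0 < f x) ->
  (mean q (fun x => lne (f x)%:E) + entropy q)%E =
  (\sum_x q x * (ln (f x) - ln (q x)))%:E.
Proof.
move=> q0 f0; rewrite /entropy !mean_lne// => [|x qx]; last by rewrite lt0r qx q0.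
rewrite -EFinN -EFinD -sumrB; congr EFin; apply: eq_bigr => x _.
by rewrite mulrBr.
Qed.

(** A term with [q x > 0] and [f x = 0] is minus infinity, which a finite mean excludes. Finiteness
    of a leaf quantity thus forces the parent factors to be positive on the support of the leaf. *)
Lemma fin_num_mean_lne q f : (forall x, 0 <= q x) -> (forall x, 0 <= f x) ->
  mean q (fun x => lne (f x)%:E) \is a fin_num -> forall x, q x != 0 -> 0 < f x.
Proof.
move=> q0 f0 /sum_fin_numP H x qx; rewrite lt0r f0 andbT.
apply/eqP => fx; have := H x (mem_index_enum _) isT.
by rewrite fx le0_lneNy// gt0_muleNy// lte_fin lt0r qx q0.
Qed.

Lemma ln_prod (Q : pred T) f : (forall x, Q x -> 0 < f x) ->
  ln (\prod_(x | Q x) f x) = \sum_(x | Q x) ln (f x).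
Proof.
move=> f0.
suff [_ //] : 0 < \prod_(x | Q x) f x /\
    ln (\prod_(x | Q x) f x) = \sum_(x | Q x) ln (f x).
elim: (index_enum T) => [|x r [r0 IH]]; first by rewrite !big_nil ln1.
rewrite !big_cons; case: ifP => // /f0 fx; split; first exact: mulr_gt0.
by rewrite lnM ?posrE// IH.
Qed.

(** Either one term carries the whole sum or all terms vanish. With [g a = a * (l - ln a)] this
    resolves the logarithm of a sum at a sum node. *)
Lemma sum_at_most_one (Q : pred T) (a : T -> R) (g : R -> R) : g 0 = 0 ->
  (forall x y, Q x -> Q y -> a x != 0 -> a y != 0 -> x = y) ->
  g (\sum_(x | Q x) a x) = \sum_(x | Q x) g (a x).
Proof.
move=> g0 a1.
have [[x /andP[Qx ax]]|/forallNP H] := pselect (exists x, Q x && (a x != 0)).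
  have z y : Q y && (y != x) -> a y = 0.
    move=> /andP[Qy yx]; apply/eqP; apply: contraNT yx => ay.
    by apply/eqP; exact: a1.
  rewrite (bigD1 x)//= [in RHS](bigD1 x)//= !big1 ?addr0// => y /z -> //.
have z y : Q y -> a y = 0.
  by move=> Qy; apply/eqP; have /negP := H y; rewrite Qy /= negbK.
by rewrite !big1// => y /z ->.
Qed.

End FreeEnergy.

(** * Straight-line programs *)

Section Programs.
Local Open Scope classical_set_scope.
Variables (R : realType) (I X : Type) (inp : X -> I -> R) (D : set X).
Implicit Types (f g h : X -> R) (A B : set (X -> R)) (P : program I).

(* The address a may not depend on the input x. *)
Definition stores P f (a : nat) : Prop :=
  forall x, D x ->
    exists2 mem, run (inp x) P [::] = Some mem & onth mem a = Some (f x).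

Definition runs P : Prop :=
  forall x, D x -> exists mem, run (inp x) P [::] = Some mem.

(** One program stores all of [A], so that intermediate values are shared and paid for once; it is
    chosen before the input [x]. *)
Definition computable (n : nat) A : Prop :=
  exists P,
    [/\ (size P <= n)%N, runs P & forall f, A f -> exists a, stores P f a].

Lemma run_rcons (ix : I -> R) P c mem :
  run ix (rcons P c) mem =
  obind (fun m => omap (rcons m) (exec ix c m)) (run ix P mem).
Proof.
elim: P mem => [|c' P IH] mem /=; first by case: exec.
by case: exec => //= x; rewrite IH.
Qed.

Lemma size_run (ix : I -> R) P mem mem' :
  run ix P mem = Some mem' -> size mem' = (size mem + size P)%N.
Proof.
elim: P mem => [|c P IH] mem /=; first by move=> [<-]; rewrite addn0.
by case: exec => //= x /IH ->; rewrite size_rcons addSnnS.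
Qed.

(** An appended instruction leaves the earlier addresses intact, and its value lands at address
    [size P]. *)
Lemma computable_step n A f : computable n A ->
  (forall P, (forall g, A g -> exists a, stores P g a) ->
     exists c, forall x mem, D x -> run (inp x) P [::] = Some mem ->
       exec (inp x) c mem = Some (f x)) ->
  computable n.+1 (f |` A).
Proof.
move=> [P [sP rP AP]] /(_ P AP)[c cP]; exists (rcons P c).
have runE x mem : D x -> run (inp x) P [::] = Some mem ->
    run (inp x) (rcons P c) [::] = Some (rcons mem (f x)).
  by move=> Dx r; rewrite run_rcons r /= (cP _ _ Dx r).
split; first by rewrite size_rcons ltnS.
  by move=> x Dx; have [mem r] := rP x Dx; exists (rcons mem (f x)); exact: runE.
move=> g [->|/AP[a ga]].
  exists (size P) => x Dx; have [mem r] := rP x Dx.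
  exists (rcons mem (f x)); first exact: runE.
  by rewrite onthE map_rcons nth_rcons size_map (size_run r) ltnn eqxx.
exists a => x Dx; have [mem r ma] := ga x Dx.
exists (rcons mem (f x)); first exact: runE.
move: ma; rewrite !onthE map_rcons nth_rcons.
by case: ltnP => // le; rewrite nth_default.
Qed.

Lemma computable0 : computable 0 set0.
Proof. by exists [::]; split=> // x _; exists [::]. Qed.

Lemma computable_mono m n A B :
  (m <= n)%N -> B `<=` A -> computable m A -> computable n B.
Proof.
move=> mn BA [P [sP rP AP]]; exists P; split=> //; first exact: leq_trans mn.
by move=> f /BA/AP.
Qed.

(** Functions that agree on [D] share an address, so no instruction is spent. *)
Lemma computable_eq n A f g : computable n A -> A f ->
  (forall x, D x -> g x = f x) -> computable n (g |` A).
Proof.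
move=> [P [sP rP AP]] Af gf; exists P; split=> // h [->|/AP//].
have [a fa] := AP _ Af; exists a => x Dx; have [mem r ma] := fa x Dx.
by exists mem => //; rewrite gf.
Qed.

Lemma computable_input n A i f : computable n A ->
  (forall x, D x -> f x = inp x i) -> computable n.+1 (f |` A).
Proof.
move=> cA fE; apply: computable_step cA _ => P AP.
by exists (Input i) => x mem Dx _; rewrite /= fE.
Qed.

Lemma computable_const n A (z : int) f : computable n A ->
  (forall x, D x -> f x = z%:~R) -> computable n.+1 (f |` A).
Proof.
move=> cA fE; apply: computable_step cA _ => P AP.
by exists (Const I z) => x mem Dx _; rewrite /= fE.
Qed.

Lemma stores_onth P f a x mem : stores P f a -> D x ->
  run (inp x) P [::] = Some mem -> onth mem a = Some (f x).
Proof. by move=> fa Dx r; have [m] := fa x Dx; rewrite r => -[<-]. Qed.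

Let computable_op n A f g h (op : R -> R -> R) (c : nat -> nat -> instr I) :
  (forall ix mem a b, exec ix (c a b) mem =
     omap (fun x => op x.1 x.2) (operands mem a b)) ->
  computable n A -> A f -> A g ->
  (forall x, D x -> h x = op (f x) (g x)) -> computable n.+1 (h |` A).
Proof.
move=> cE cA Af Ag hE; apply: computable_step cA _ => P AP.
have [[a fa] [b gb]] := (AP _ Af, AP _ Ag).
exists (c a b) => x mem Dx r; rewrite cE /operands.
by rewrite (stores_onth fa Dx r) (stores_onth gb Dx r) /= hE.
Qed.

Lemma computable_add n A f g h : computable n A -> A f -> A g ->
  (forall x, D x -> h x = f x + g x) -> computable n.+1 (h |` A).
Proof. by move=> cA Af Ag hE; exact: (computable_op (op := fun a b => a + b)
  (c := @Defs.Add I) _ cA Af Ag hE). Qed.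

Lemma computable_sub n A f g h : computable n A -> A f -> A g ->
  (forall x, D x -> h x = f x - g x) -> computable n.+1 (h |` A).
Proof. by move=> cA Af Ag hE; exact: (computable_op (op := fun a b => a - b)
  (c := @Defs.Sub I) _ cA Af Ag hE). Qed.

Lemma computable_mul n A f g h : computable n A -> A f -> A g ->
  (forall x, D x -> h x = f x * g x) -> computable n.+1 (h |` A).
Proof. by move=> cA Af Ag hE; exact: (computable_op (op := fun a b => a * b)
  (c := @Defs.Mul I) _ cA Af Ag hE). Qed.

Lemma computable_ln n A f h : computable n A -> A f ->
  (forall x, D x -> 0 < f x) ->
  (forall x, D x -> h x = ln (f x)) -> computable n.+1 (h |` A).
Proof.
move=> cA Af f0 hE; apply: computable_step cA _ => P AP.
have [a fa] := AP _ Af; exists (Log I a) => x mem Dx r.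
by rewrite /= (stores_onth fa Dx r) /= f0// hE.
Qed.

Let computable_sum_seq (J : eqType) (s : seq J) (t : J -> X -> R) k n A b f :
  (forall j m B, j \in s -> A `<=` B -> computable m B ->
     computable (m + k) (t j |` B)) ->
  computable n A -> A b ->
  (forall x, D x -> f x = b x + \sum_(j <- s) t j x) ->
  computable (n + size s * k.+1) (f |` A).
Proof.
elim: s n A b => [|j s IH] n A b tP cA Ab fE.
  rewrite addn0; apply: computable_eq cA Ab _ => x Dx.
  by rewrite fE// big_nil addr0.
have cj := tP j _ _ (mem_head _ _) (@subset_refl _ A) cA.
pose b' x := b x + t j x.
have cb : computable (n + k).+1 (b' |` (t j |` A)).
  by apply: (computable_add (f := b) (g := t j) cj) => //; [right|left].
have := IH _ _ b' _ cb.
have -> : ((n + k).+1 + size s * k.+1 = n + size (j :: s) * k.+1)%N.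
  by rewrite /= mulSn addnA addnS.
move=> H; apply: computable_mono (leqnn _) _ (H _ _ _).
- by move=> g [->|Ag]; [left|right; right; right].
- move=> j' m B sj' sB; apply: tP; first by rewrite inE sj' orbT.
  by move=> g Ag; apply: sB; right; right.
- by left.
- by move=> x Dx; rewrite fE// big_cons addrA.
Qed.

(** Each term costs [k] instructions and one addition to an accumulator that starts from the stored
    [b]. The terms are taken over any larger [B] because earlier terms and partial sums stay in
    memory. *)
Lemma computable_sum (J : finType) (Q : pred J) (t : J -> X -> R) k n A b f :
  (forall j m B, Q j -> A `<=` B -> computable m B ->
     computable (m + k) (t j |` B)) ->
  computable n A -> A b ->
  (forall x, D x -> f x = b x + \sum_(j | Q j) t j x) ->
  computable (n + #|Q| * k.+1) (f |` A).
Proof.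
move=> tP cA Ab fE; rewrite cardE.
apply: (computable_sum_seq (b := b) (t := t)) => // [j m B|x Dx].
  by rewrite mem_enum => Qj; exact: tP.
by rewrite big_enum; exact: fE.
Qed.

(** Sorting the indices by rank makes every value of smaller rank available in time. With ranks
    given by layers this is one pass over the network; with a constant rank it is a plain loop. *)
Lemma computable_rank (J : finType) (r : J -> nat) (F : J -> X -> R)
    (k : J -> nat) n A :
  (forall j m B, A `<=` B -> (forall i, (r i < r j)%N -> B (F i)) ->
     computable m B -> computable (m + k j) (F j |` B)) ->
  computable n A ->
  exists B, [/\ A `<=` B, forall j, B (F j) & computable (n + \sum_j k j) B].
Proof.
move=> FP cA; pose le := relpre r leq.
have le_tr : transitive le by move=> a b c; exact: leq_trans.
pose s := sort le (enum J).
have ss : sorted le s by apply: sort_sorted => i j; exact: leq_total.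
have -> : \sum_j k j = \sum_(j <- s) k j.
  by rewrite -[LHS]big_enum; apply: perm_big; rewrite perm_sym perm_sort.
(* Invariant: an index of smaller rank than a pending one is itself pending or already stored. For
   the head of a sorted list only the second case remains. *)
suff gen : forall s n B, sorted le s -> A `<=` B ->
    (forall i j, j \in s -> (r i < r j)%N -> i \in s \/ B (F i)) ->
    computable n B ->
    computable (n + \sum_(j <- s) k j) (B `|` [set F j | j in [set` s]]).
  have memS j : j \in s by rewrite mem_sort mem_enum.
  have c := gen s n A ss (@subset_refl _ A) (fun i j _ _ => or_introl (memS i)) cA.
  eexists; split; last exact: c; first by move=> f Af; left.
  by move=> j; right; exists j => //; exact: memS.
elim=> {s ss cA n} [|j s IH] n B ss AB sB cB.
  by rewrite big_nil addn0; apply: computable_mono cB => // f [|[]].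
have cj : computable (n + k j) (F j |` B).
  apply: FP => // i ij; have [|//] := sB i j (mem_head _ _) ij.
  rewrite inE => /orP[/eqP eij|si]; first by rewrite eij ltnn in ij.
  have := order_path_min le_tr ss => /allP/(_ _ si).
  by rewrite /le /= leqNgt ij.
have := IH _ (F j |` B) (path_sorted ss) _ _ cj.
rewrite big_cons addnA => H; apply: computable_mono (leqnn _) _ (H _ _).
- move=> f [Bf|[i /=]]; first by left; right.
  rewrite inE => /orP[/eqP -> <-|si <-]; first by left; left.
  by right; exists i.
- by move=> f Af; right; exact: AB.
- move=> i j' sj' ij'; have sj : j' \in j :: s by rewrite inE sj' orbT.
  have [|Bi] := sB i j' sj ij'; last by right; right.
  by rewrite inE => /orP[/eqP ->|]; [right; left|left].
Qed.

End Programs.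

(** * Sums over orderings and parent sets *)

(** Iterating [F] stabilizes at [x] after [(r x).+1] rounds. This provides the adjoints, whose
    equations refer to nodes of smaller layer. *)
Lemma rank_recursion (T X : Type) (x0 : X) (r : T -> nat)
    (F : (T -> X) -> T -> X) :
  (forall f g x, (forall y, (r y < r x)%N -> f y = g y) -> F f x = F g x) ->
  exists f, forall x, f x = F f x.
Proof.
move=> Floc; pose it n := iter n F (fun=> x0).
have itE n m x : (r x < n)%N -> (r x < m)%N -> it n x = it m x.
  elim: n m x => // n IH [//|m] x rn rm.
  by apply: Floc => y ry; apply: IH; apply: leq_trans ry _.
exists (fun x => it (r x).+1 x) => x; apply: Floc => y ry.
exact: itE.
Qed.

Section Words.
Variable T : finType.

Fixpoint words (n : nat) : seq (seq T) :=
  if n is m.+1 then [seq x :: s | x <- enum T, s <- words m] else [:: [::]].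

Lemma mem_words n s : (s \in words n) = (size s == n).
Proof.
elim: n s => [|n IH] [|x s] //=.
- by apply/negbTE/allpairsP => -[[y t] [_ _]].
- rewrite eqSS -IH; apply/allpairsP/idP => [[[y t] /= [_ ts [_ ->]]] //|ws].
  by exists (x, s); rewrite mem_enum.
Qed.

Lemma words_uniq n : uniq (words n).
Proof.
elim: n => //= n IH; apply: allpairs_uniq => //; first exact: enum_uniq.
by move=> [x s] [y t] _ _ /= [-> ->].
Qed.

Lemma sum_words_cat (V : nmodType) m n (F : seq T -> V) :
  \sum_(s <- words (m + n)) F s =
  \sum_(s1 <- words m) \sum_(s2 <- words n) F (s1 ++ s2).
Proof.
elim: m F => [|m IH] F; first by rewrite big_seq1.
by rewrite /= !big_allpairs_dep; apply: eq_bigr => x _; rewrite IH.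
Qed.

End Words.

(** Listings of permutations are exactly the duplicate-free words of length [d]. Allowing all words
    is what makes the sums split under concatenation. *)
Lemma sum_perm_words (V : nmodType) d (F : seq 'I_d -> V) :
  (forall s, ~~ uniq s -> F s = 0) ->
  \sum_(p : {perm 'I_d}) F [seq p k | k <- enum 'I_d] =
  \sum_(s <- words 'I_d d) F s.
Proof.
move=> F0; pose list (p : {perm 'I_d}) := [seq p k | k <- enum 'I_d].
rewrite (bigID uniq) /= [X in _ + X]big1 ?addr0 => [|s /F0 //].
rewrite -big_filter -[LHS]big_enum -(big_map list xpredT).
apply: perm_big; apply: uniq_perm.
- rewrite map_inj_uniq ?enum_uniq// => p q /eq_in_map pq.
  by apply/permP => i; apply: pq; rewrite mem_enum.
- by rewrite filter_uniq// words_uniq.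
move=> s; rewrite mem_filter mem_words; apply/mapP/andP.
  move=> [p _ ->]; rewrite size_map size_enum_ord map_inj_uniq ?enum_uniq//.
  exact: perm_inj.
move=> [us sd]; pose t := Tuple sd.
have t_inj : injective (tnth t) by apply/tuple_uniqP.
exists (perm t_inj); first by rewrite mem_enum.
transitivity (tval t) => //; rewrite -map_tnth_enum.
by apply: eq_map => i; rewrite permE.
Qed.

Section LocalSums.
Variables (d : nat) (R : realType).
Implicit Types (S : {set 'I_d}) (G : digraph d) (F : seq 'I_d -> digraph d -> R).

Definition supported S G : bool :=
  [forall i, (i \in S) || (G i == finset.set0)].

Definition glue G1 G2 : digraph d := [ffun i => G1 i :|: G2 i].

Lemma supported_out S G i : supported S G -> i \notin S -> G i = finset.set0.
Proof. by move=> /forallP/(_ i)/orP[->//|/eqP]. Qed.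

Lemma glueC G1 G2 : glue G1 G2 = glue G2 G1.
Proof. by apply/ffunP => i; rewrite !ffunE finset.setUC. Qed.

Lemma glue_left S1 S2 G1 G2 i : [disjoint S1 & S2] -> supported S2 G2 ->
  i \in S1 -> glue G1 G2 i = G1 i.
Proof.
move=> dS sG iS; rewrite ffunE (supported_out sG) ?finset.setU0//.
by rewrite (disjointFr dS iS).
Qed.

Lemma glue_right S1 S2 G1 G2 i : [disjoint S1 & S2] -> supported S1 G1 ->
  i \in S2 -> glue G1 G2 i = G2 i.
Proof. by rewrite disjoint_sym glueC; exact: glue_left. Qed.

(** Restriction to [S1] and to [S2] inverts [glue], because each part is empty outside its own
    set. *)
Lemma sum_supportedU (V : nmodType) S1 S2 (f : digraph d -> V) :
  [disjoint S1 & S2] ->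
  \sum_(G | supported (S1 :|: S2) G) f G =
  \sum_(G1 | supported S1 G1) \sum_(G2 | supported S2 G2) f (glue G1 G2).
Proof.
move=> dS; pose restr S G : digraph d :=
  [ffun i => if i \in S then G i else finset.set0].
rewrite pair_big /= (reindex_onto (fun p => glue p.1 p.2)
  (fun G => (restr S1 G, restr S2 G))) /=; last first.
  move=> G sG; apply/ffunP => i; rewrite !ffunE.
  case: ifPn => i1; case: ifPn => i2;
    rewrite ?finset.setUid ?finset.setU0 ?finset.set0U//.
  by rewrite (supported_out sG)// inE negb_or i1.
apply: eq_bigl => -[G1 G2] /=; apply/andP/andP => [[_ /eqP[<- <-]]|[s1 s2]].
  by split; apply/forallP => i; rewrite ffunE; case: ifP => //=.
split.
  apply/forallP => i; rewrite inE ffunE; case: (boolP (i \in S1)) => //= i1.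
  case: (boolP (i \in S2)) => //= i2.
  by rewrite (supported_out s1)// (supported_out s2)// finset.setU0.
apply/eqP; congr pair; apply/ffunP => i; rewrite ffunE; case: ifPn => iS.
- exact: glue_left dS s2 iS.
- by rewrite (supported_out s1).
- exact: glue_right dS s1 iS.
- by rewrite (supported_out s2).
Qed.

(* Every word of length #|S| counts, but the distribution of a node with scope S
   vanishes at those that do not list S; the parent sets outside S are fixed to
   be empty. *)
Definition tot S F : R :=
  \sum_(s <- words 'I_d #|S|) \sum_(G | supported S G) F s G.

Lemma eq_tot S F1 F2 :
  (forall s G, size s = #|S| -> supported S G -> F1 s G = F2 s G) ->
  tot S F1 = tot S F2.
Proof.
move=> F12; rewrite /tot big_seq [RHS]big_seq; apply: eq_bigr => s.
by rewrite mem_words => /eqP sz; apply: eq_bigr => G; exact: F12.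
Qed.

Lemma totD S F1 F2 :
  tot S (fun s G => F1 s G + F2 s G) = tot S F1 + tot S F2.
Proof.
rewrite /tot -big_split /=; apply: eq_bigr => s _; exact: big_split.
Qed.

Lemma totZ S c F : tot S (fun s G => c * F s G) = c * tot S F.
Proof.
rewrite /tot mulr_sumr; apply: eq_bigr => s _; by rewrite mulr_sumr.
Qed.

Lemma tot_sum (J : finType) (Q : pred J) S (F : J -> seq 'I_d -> digraph d -> R) :
  tot S (fun s G => \sum_(j | Q j) F j s G) = \sum_(j | Q j) tot S (F j).
Proof.
rewrite /tot [RHS]exchange_big /=; apply: eq_bigr => s _; exact: exchange_big.
Qed.

(** By disjointness the cardinals add up, so every word is cut at position [#|S1|] while the graph
    is split between the two sets. *)
Lemma totU S1 S2 F : [disjoint S1 & S2] ->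
  tot (S1 :|: S2) F =
  tot S1 (fun s1 G1 => tot S2 (fun s2 G2 => F (s1 ++ s2) (glue G1 G2))).
Proof.
move=> dS; rewrite /tot cardsU (eqP (_ : S1 :&: S2 == finset.set0)) ?setI_eq0//.
rewrite cards0 subn0 sum_words_cat. apply: eq_bigr => s1 _.
rewrite [RHS]exchange_big /=. apply: eq_bigr => s2 _; exact: sum_supportedU.
Qed.

Lemma tot_prod S1 S2 F F1 F2 : [disjoint S1 & S2] ->
  (forall s1 s2 G1 G2, size s1 = #|S1| -> supported S1 G1 -> supported S2 G2 ->
     F (s1 ++ s2) (glue G1 G2) = F1 s1 G1 * F2 s2 G2) ->
  tot (S1 :|: S2) F = tot S1 F1 * tot S2 F2.
Proof.
move=> dS FE; rewrite totU// mulrC -totZ; apply: eq_tot => s1 G1 z1 g1.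
rewrite mulrC -totZ; apply: eq_tot => s2 G2 z2 g2; exact: FE.
Qed.

Lemma tot_set1 i (f : {set 'I_d} -> R) :
  tot [set i]%SET (fun s G => (s == [:: i])%:R * f (G i)) = \sum_A f A.
Proof.
rewrite /tot cards1 (bigD1_seq [:: i]) ?words_uniq ?mem_words//= eqxx.
rewrite [X in _ + X]big1 ?addr0 => [|s /negPf ->]; last first.
  by apply: big1 => G _; rewrite mul0r.
pose mk A : digraph d := [ffun j => if j == i then A else finset.set0].
rewrite (reindex_onto mk (fun G => G i)) /=; last first.
  move=> G sG; apply/ffunP => j; rewrite ffunE; case: eqP => [->//|/eqP ji].
  by rewrite (supported_out sG)// inE.
apply: eq_big => [A|A _]; last by rewrite mul1r ffunE eqxx.
rewrite ffunE !eqxx andbT; apply/forallP => j.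
by rewrite inE ffunE; case: (j == i) => /=; rewrite ?eqxx.
Qed.

Lemma tot_setT F : (forall s G, ~~ uniq s -> F s G = 0) ->
  \sum_(x : {perm 'I_d} * digraph d) F [seq x.1 k | k <- enum 'I_d] x.2 =
  tot [set: 'I_d]%SET F.
Proof.
move=> F0; rewrite /tot cardsT card_ord -sum_perm_words; last first.
  by move=> s us; apply: big1 => G _; exact: F0.
rewrite -(pair_big xpredT xpredT
  (fun (p : {perm 'I_d}) G => F [seq p k | k <- enum 'I_d] G)) /=.
apply: eq_bigr => p _; apply: eq_bigl => G.
by apply/esym/forallP => i; rewrite inE.
Qed.

End LocalSums.

(** * The structure of an order SPN *)

Section Structure.
Variables (d : nat) (N : spn d).
Implicit Types v c : node N.

Definition scope v : {set 'I_d} :=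
  match lab v with
  | Leaf _ i => [set i]%SET
  | Sum _ S2 => S2
  | Prod _ S21 S22 => S21 :|: S22
  end.

Definition context v : {set 'I_d} :=
  match lab v with Leaf S1 _ => S1 | Sum S1 _ => S1 | Prod S1 _ _ => S1 end.

Lemma assocP v S1 S2 : assoc v = Some (S1, S2) -> context v = S1 /\ scope v = S2.
Proof.
by rewrite /assoc /context /scope; case: (lab v) => [? ?|? ?|//] [-> ->].
Qed.

Variant node_spec v : Prop :=
| LeafNode S1 i of lab v = Leaf S1 i & children v = [::]
| SumNode S1 S2 of lab v = Sum S1 S2
| ProdNode S1 S21 S22 c1 c2 of
    lab v = Prod S1 S21 S22 & children v = [:: c1; c2] &
    [disjoint S21 & S22] &
    context c1 = S1 /\ scope c1 = S21 & context c2 = S1 :|: S21 /\ scope c2 = S22.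

(* Edges with multiplicity, as counted by spn_size. *)
Definition arrow : finType := {v : node N & 'I_(size (children v))}.
Definition src (e : arrow) : node N := tag e.
Definition tgt (e : arrow) : node N :=
  nth (tag e) (children (tag e)) (tagged e).

Lemma edge_arrow (e : arrow) : edge (src e) (tgt e).
Proof. by apply: mem_nth; exact: ltn_ord. Qed.

Lemma card_arrow : #|arrow| = spn_size N.
Proof.
rewrite card_tagged sumnE big_map big_enum /=.
by apply: eq_bigr => v _; rewrite card_ord.
Qed.

Lemma sum_src (V : nmodType) (f : arrow -> V) v :
  \sum_(e | src e == v) f e =
  \sum_(k < size (children v)) f (existT (fun u => 'I_(size (children u))) v k).
Proof.
pose F v := \sum_(k < size (children v))
  f (existT (fun u => 'I_(size (children u))) v k).
rewrite -/(F v) -(big_pred1_eq +%R v F) /F.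
rewrite (sig_big_dep (pred1 v) (fun _ => xpredT)) /=.
by apply: eq_big => [e|[u k] //]; rewrite andbT.
Qed.

Hypothesis oN : order_spn N.
Hypothesis bN : balanced_splits N.
Variable layer : node N -> nat.
Hypothesis layer_root : layer (Defs.root N) = 0%N.
Hypothesis layer_edge : forall v c, edge v c -> layer c = (layer v).+1.

Lemma nodeP v : node_spec v.
Proof.
have [_ _ /(_ v)] := oN; rewrite /local_wf.
case E: (lab v) => [S1 i|S1 S2|S1 S21 S22].
- by move=> [_ cv]; exact: LeafNode E cv.
- by move=> _; exact: SumNode E.
- move=> [_ dS [c1 [c2 [cv /assocP a1 /assocP a2]]]].
  exact: ProdNode E cv dS a1 a2.
Qed.

Lemma sum_childP v c S1 S2 : lab v = Sum S1 S2 -> edge v c ->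
  exists S21 S22, [/\ lab c = Prod S1 S21 S22, S21 :|: S22 = S2,
    [disjoint S21 & S22] & #|S21| = #|S2|./2].
Proof.
move=> vS vc; have [_ _ /(_ v)] := oN; rewrite /local_wf vS => -[_ _ _ /(_ c vc)].
move=> [S21 [S22 [cP S2E dS _ _]]]; exists S21, S22; split=> //.
by have [/(_ c vc)[]] := bN vS; rewrite /parts cP.
Qed.

Lemma scope_child v c S1 S2 : lab v = Sum S1 S2 -> edge v c -> scope c = scope v.
Proof.
by move=> vS /(sum_childP vS)[S21 [S22 [cP S2E _ _]]]; rewrite /scope cP vS.
Qed.

Lemma context_child v c S1 S2 :
  lab v = Sum S1 S2 -> edge v c -> context c = context v.
Proof.
by move=> vS /(sum_childP vS)[S21 [S22 [cP S2E _ _]]]; rewrite /context cP vS.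
Qed.

(** The layer is the length of a path from the root, which can be taken without repeated nodes. This
    bounds both the fuel and the induction from parents to children. *)
Lemma layer_lt_card v : (layer v < #|node N|)%N.
Proof.
have [[/(_ v) /connectP[p rp ->] _] _ _] := oN.
case/shortenP: rp => p' rp' up' _.
suff -> : layer (last (Defs.root N) p') = size p'.
  rewrite -[X in (X <= _)%N]/(size (Defs.root N :: p')) -(card_uniqP up').
  exact: max_card.
suff H : forall u, path (@edge _ N) u p' ->
    layer (last u p') = (layer u + size p')%N by rewrite H// layer_root.
elim: p' {rp' up'} => [|c p' IH] u /=; first by rewrite addn0.
by move=> /andP[/layer_edge uc /IH ->]; rewrite uc addSnnS.
Qed.

Lemma node_ind_down (P : node N -> Prop) :
  (forall v, (forall c, edge v c -> P c) -> P v) -> forall v, P v.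
Proof.
move=> PI v; have [n] := ubnP (#|node N| - layer v); elim: n v => // n IH v nv.
apply: PI => c /layer_edge lc; apply: IH.
by have := layer_lt_card v; rewrite lc; move: nv; lia.
Qed.

Variable R : realType.
Implicit Types (phi : 'rV[R]_#|param N|) (L : node N -> {set 'I_d} -> R).

(** A recursive call spends one unit of fuel and descends one layer, so the bound persists; fuel 0
    is excluded since layers stay below the number of nodes. *)
Lemma node_dist_rec_fuel phi L n m v s G :
  (#|node N| <= n + layer v)%N -> (#|node N| <= m + layer v)%N ->
  node_dist_rec phi L n v s G = node_dist_rec phi L m v s G.
Proof.
elim: n m v s G => [|n IH] m v s G.
  by move=> /leq_trans/(_ (leqnn _)); have := layer_lt_card v; lia.
case: m => [|m] nl ml; first by have := layer_lt_card v; lia.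
have lc c : edge v c ->
    (#|node N| <= n + layer c)%N /\ (#|node N| <= m + layer c)%N.
  by move=> /layer_edge ->; rewrite !addnS -!addSn.
rewrite /=; case E: (lab v) => [S1 i|S1 S2|S1 S21 S22] //.
- apply: eq_bigr => k _; congr (_ * _).
  have /lc[] : edge v (nth v (children v) k).
    by apply: mem_nth; apply: leq_trans (ltn_ord k) _; rewrite /arity /is_sum E.
  exact: IH.
- case cE: (children v) => [//|c1 [//|c2 [|//]]].
  have [] : edge v c1 /\ edge v c2 by rewrite /edge cE !inE !eqxx orbT.
  by move=> /lc[n1 m1] /lc[n2 m2]; congr (_ * _); exact: IH.
Qed.

(** * Recursion, locality and support of the node distributions *)

Section NodeDist.
Variables (phi : 'rV[R]_#|param N|) (L : node N -> {set 'I_d} -> R).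
Local Notation q := (node_dist phi L).

(* The value 1 on the edges out of product nodes lets the recursions treat all
   edges alike. *)
Definition edge_weight (psi : 'rV[R]_#|param N|) (e : arrow) : R :=
  if insub (val (tagged e)) is Some k
  then weight psi (existT (fun u => 'I_(arity u)) (tag e) k) else 1.

Let card_node : exists n, #|node N| = n.+1.
Proof.
exists #|node N|.-1; rewrite prednK//.
by apply/card_gt0P; exists (Defs.root N).
Qed.

Let fuel_child n v c s G : #|node N| = n.+1 -> edge v c ->
  node_dist_rec phi L n c s G = q c s G.
Proof.
move=> nN vc; apply: node_dist_rec_fuel; rewrite (layer_edge vc) nN; lia.
Qed.

Lemma node_dist_leaf v S1 i s G : lab v = Leaf S1 i ->
  q v s G = (s == [:: i])%:R * L v (G i).
Proof. by move=> vE; have [n nN] := card_node; rewrite /node_dist nN /= vE. Qed.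

Lemma node_dist_sum v S1 S2 s G : lab v = Sum S1 S2 ->
  q v s G = \sum_(e | src e == v) edge_weight phi e * q (tgt e) s G.
Proof.
move=> vE; have [n nN] := card_node; rewrite {1}/node_dist nN /= vE sum_src.
have aE : arity v = size (children v) by rewrite /arity /is_sum vE.
rewrite (reindex (cast_ord (esym aE))) /=; last first.
  by exists (cast_ord aE) => k _; rewrite ?cast_ordK ?cast_ordKV.
apply: eq_bigr => k _; rewrite (@fuel_child n v)//; last first.
  by apply: mem_nth; exact: ltn_ord.
by rewrite /edge_weight /= (valK (cast_ord (esym aE) k)).
Qed.

Lemma node_dist_prod v S1 S21 S22 c1 c2 s G : lab v = Prod S1 S21 S22 ->
  children v = [:: c1; c2] ->
  q v s G = q c1 (take #|S21| s) G * q c2 (drop #|S21| s) G.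
Proof.
move=> vE cE; have [n nN] := card_node; rewrite {1}/node_dist nN /= vE cE.
by rewrite !(@fuel_child n v)// /edge cE !inE !eqxx ?orbT.
Qed.

(** At a product node each factor therefore sees only its own part of a glued graph, so the sum over
    graphs factors. *)
Lemma node_dist_local v s (G G' : digraph d) :
  (forall i, i \in scope v -> G i = G' i) ->
  q v s G = q v s G'.
Proof.
elim/node_ind_down: v s => v IH s GG.
case: (nodeP v) => [S1 i vE _|S1 S2 vE|S1 S21 S22 c1 c2 vE cE _ [_ c1E] [_ c2E]].
- by rewrite !(node_dist_leaf _ _ vE) GG// /scope vE inE.
- rewrite !(node_dist_sum _ _ vE); apply: eq_bigr => e /eqP ev; congr (_ * _).
  have ve := edge_arrow e; rewrite ev in ve.
  by apply: IH => // i; rewrite (scope_child vE ve); exact: GG.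
- rewrite !(node_dist_prod _ _ vE cE); congr (_ * _); apply: IH;
    rewrite ?/edge ?cE ?inE ?eqxx ?orbT// => i; rewrite ?c1E ?c2E => iS;
    by apply: GG; rewrite /scope vE inE iS ?orbT.
Qed.

Variable pos : 'I_d -> {set 'I_d} -> Prop.
Hypothesis Lpos : forall v S1 i A, lab v = Leaf S1 i -> L v A != 0 ->
  A \subset S1 /\ pos i A.

(** At a product node the second child has [S1 :|: S21] as context, and [S21] is what the first half
    of the word lists; so parents lie in the context or earlier in the word. At the root the context
    is empty, and this says that the graph respects the order. The predicate [pos] is later
    instantiated with positivity of the parent factors. *)
Lemma node_dist_supp v s (G : digraph d) : q v s G != 0 ->
  [/\ uniq s, s =i scope v &
    forall i, i \in scope v ->
      G i \subset context v :|: [set j | (index j s < index i s)%N]%SET /\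
      pos i (G i)].
Proof.
elim/node_ind_down: v s => v IH s.
case: (nodeP v) => [S1 i vE _|S1 S2 vE|S1 S21 S22 c1 c2 vE cE dS [x1 c1E] [x2 c2E]].
- rewrite (node_dist_leaf _ _ vE) mulf_eq0 negb_or pnatr_eq0 eqb0 negbK.
  move=> /andP[/eqP -> /(Lpos vE)[GS Gi]]; rewrite /scope /context vE; split=> //.
    by move=> j; rewrite !inE.
  move=> j; rewrite inE => /eqP ->; split=> //.
  exact: (fintype.subset_trans GS (finset.subsetUl _ _)).
- rewrite (node_dist_sum _ _ vE) => qv.
  have [e /andP[/eqP ev qe]] : exists e, (src e == v) && (q (tgt e) s G != 0).
    apply: contrapT => /forallNP H; move/eqP: qv; apply; apply: big1 => e ev.
    by have /negP := H e; rewrite ev /= negbK => /eqP ->; rewrite mulr0.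
  have ve := edge_arrow e; rewrite ev in ve.
  by have := IH _ ve _ qe; rewrite (scope_child vE ve) (context_child vE ve).
- rewrite (node_dist_prod _ _ vE cE) mulf_eq0 negb_or => /andP[q1 q2].
  have [v1 v2] : edge v c1 /\ edge v c2 by rewrite /edge cE !inE !eqxx orbT.
  have [u1 m1 G1] := IH _ v1 _ q1; have [u2 m2 G2] := IH _ v2 _ q2.
  have sE : s = take #|S21| s ++ drop #|S21| s by rewrite cat_take_drop.
  move: (take _ s) (drop _ s) => s1 s2 in sE u1 m1 G1 u2 m2 G2 *.
  rewrite {}sE /scope /context vE; rewrite x1 c1E x2 c2E in m1 G1 m2 G2.
  have s12 j : j \in S22 -> j \notin s1.
    by move=> j2; rewrite m1 (disjointFl dS j2).
  split.
  + rewrite cat_uniq u1 u2 andbT; apply/hasPn => j; rewrite m2; exact: s12.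
  + by move=> j; rewrite mem_cat inE m1 m2.
  + move=> i; rewrite inE => /orP[i1|i2].
      have [Gi ?] := G1 i i1; split=> //; apply: (fintype.subset_trans Gi).
      apply/fintype.subsetP => j; rewrite !inE !index_cat (m1 i) i1 m1.
      case/orP => [->//|ji]; case: ifPn => [j1|j1]; first by rewrite ji orbT.
      (* The index of an absent element is the length of the word, so such a [j] cannot precede [i]
         in [s1]. *)
      move: ji; rewrite memNindex ?m1// ltnNge ltnW ?orbF// index_mem m1.
      by [].
    have [Gi ?] := G2 i i2; split=> //; apply: (fintype.subset_trans Gi).
    apply/fintype.subsetP => j; rewrite !inE !index_cat.
    rewrite (negPf (s12 _ i2)) m1.
    case/orP => [/orP[->//|j1]|ji].
      rewrite j1; apply/orP; right; apply: leq_trans (leq_addr _ _).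
      by rewrite index_mem m1.
    case: ifPn => j1; last by rewrite ltn_add2l ji orbT.
    apply/orP; right; apply: leq_trans (leq_addr _ _).
    by rewrite index_mem m1.
Qed.

End NodeDist.

(** * Mass and score of a node *)

Section Scores.
Variables (pG : 'I_d -> {set 'I_d} -> R) (L : node N -> {set 'I_d} -> R).
Hypothesis pG0 : forall i A, 0 <= pG i A.
Hypothesis Ldist : leaf_dists L.
Hypothesis Lfin :
  forall v, is_leaf v -> leaf_quantity pG L v \is a fin_num.
Implicit Type w : 'rV[R]_#|param N|.

Definition positive_weights w : Prop := forall e, 0 < weight w e.

Definition log_parents v (G : digraph d) : R :=
  \sum_(i in scope v) ln (pG i (G i)).

Definition mass w v : R := tot (scope v) (node_dist w L v).

(** The real [ln] suffices: where the distribution vanishes, the factor 0 hides its value at 0. *)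
Definition score w v : R :=
  tot (scope v) (fun s G => node_dist w L v s G *
    (log_parents v G - ln (node_dist w L v s G))).

Definition leaf_score v : R := fine (leaf_quantity pG L v).

Lemma edge_weight_gt0 w (e : arrow) : positive_weights w -> 0 < edge_weight w e.
Proof. by move=> w0; rewrite /edge_weight; case: insubP. Qed.

Lemma leaf_supp v S1 i A : lab v = Leaf S1 i -> L v A != 0 ->
  A \subset S1 /\ 0 < pG i A.
Proof.
move=> vE LA; have [[L0 _] LS] := Ldist vE; split; first exact: LS.
have : leaf_quantity pG L v \is a fin_num by apply: Lfin; rewrite /is_leaf vE.
rewrite /leaf_quantity vE fin_numD => /andP[/fin_num_mean_lne H _].
exact: H.
Qed.

Lemma leaf_scoreE v S1 i : lab v = Leaf S1 i ->
  leaf_score v = \sum_A L v A * (ln (pG i A) - ln (L v A)).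
Proof.
move=> vE; have [[L0 _] LS] := Ldist vE.
rewrite /leaf_score /leaf_quantity vE mean_lneD_entropy// => A.
by move=> /(leaf_supp vE)[].
Qed.

Lemma node_dist_ge0 w v s (G : digraph d) : positive_weights w ->
  0 <= node_dist w L v s G.
Proof.
move=> w0; elim/node_ind_down: v s => v IH s.
case: (nodeP v) => [S1 i vE _|S1 S2 vE|S1 S21 S22 c1 c2 vE cE _ _ _].
- by rewrite (node_dist_leaf _ _ _ _ vE) mulr_ge0//; have [[]] := Ldist vE.
- rewrite (node_dist_sum _ _ _ _ vE); apply: sumr_ge0 => e /eqP ev.
  apply: mulr_ge0; first exact: ltW (edge_weight_gt0 _ _).
  by apply: IH; rewrite -ev; exact: edge_arrow.
- rewrite (node_dist_prod _ _ _ _ vE cE).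
  by apply: mulr_ge0; apply: IH; rewrite /edge cE !inE !eqxx ?orbT.
Qed.

Lemma mass_leaf w v S1 i : lab v = Leaf S1 i -> mass w v = 1.
Proof.
move=> vE; have [[_ <-] _] := Ldist vE.
rewrite /mass /scope vE -(tot_set1 i); apply: eq_tot => s G _ _.
exact: node_dist_leaf vE.
Qed.

Lemma mass_sum w v S1 S2 : lab v = Sum S1 S2 ->
  mass w v = \sum_(e | src e == v) edge_weight w e * mass w (tgt e).
Proof.
move=> vE; rewrite /mass.
rewrite (eq_tot (F2 := fun s G => \sum_(e | src e == v)
  edge_weight w e * node_dist w L (tgt e) s G)); last first.
  by move=> s G _ _; exact: node_dist_sum vE.
rewrite tot_sum; apply: eq_bigr => e /eqP ev; rewrite totZ.
by rewrite (scope_child vE (_ : edge v (tgt e)))// -ev edge_arrow.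
Qed.

Section ProductNode.
Variables (w : 'rV[R]_#|param N|) (v : node N) (S1 S21 S22 : {set 'I_d}).
Variables c1 c2 : node N.
Hypotheses (vE : lab v = Prod S1 S21 S22) (cE : children v = [:: c1; c2]).
Hypotheses (dS : [disjoint S21 & S22]).
Hypotheses (c1E : scope c1 = S21) (c2E : scope c2 = S22).

(** Cutting at [#|S21|] recovers the two words, and locality removes the foreign part of the glued
    graph from each factor. *)
Let tot_local F1 F2 :
  (forall s (G G' : digraph d), (forall i, i \in S21 -> G i = G' i) ->
     F1 s G = F1 s G') ->
  (forall s (G G' : digraph d), (forall i, i \in S22 -> G i = G' i) ->
     F2 s G = F2 s G') ->
  tot (scope v) (fun s G => F1 (take #|S21| s) G * F2 (drop #|S21| s) G) =
  tot S21 F1 * tot S22 F2 :> R.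
Proof.
move=> l1 l2; rewrite /scope vE; apply: tot_prod => // s1 s2 G1 G2 z1 g1 g2.
rewrite -z1 take_size_cat// drop_size_cat//; congr (_ * _).
  by apply: l1 => i i1; rewrite (glue_left _ dS).
by apply: l2 => i i2; rewrite (glue_right _ dS).
Qed.

Let loc c s (G G' : digraph d) : (forall i, i \in scope c -> G i = G' i) ->
  node_dist w L c s G = node_dist w L c s G'.
Proof. exact: node_dist_local. Qed.

Let loc_score c s (G G' : digraph d) : (forall i, i \in scope c -> G i = G' i) ->
  node_dist w L c s G * (log_parents c G - ln (node_dist w L c s G)) =
  node_dist w L c s G' * (log_parents c G' - ln (node_dist w L c s G')).
Proof.
move=> GG; rewrite (loc _ GG); congr (_ * (_ - _)).
by apply: eq_bigr => i /GG ->.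
Qed.

Lemma mass_prod : mass w v = mass w c1 * mass w c2.
Proof.
rewrite /mass c1E c2E -tot_local.
- by apply: eq_tot => s G _ _; exact: node_dist_prod vE cE.
- by move=> s G G'; rewrite -c1E; exact: loc.
- by move=> s G G'; rewrite -c2E; exact: loc.
Qed.

Lemma score_prod : positive_weights w ->
  score w v = score w c1 * mass w c2 + mass w c1 * score w c2.
Proof.
move=> w0; have [l1 l2] := (@loc c1, @loc c2).
have [ls1 ls2] := (@loc_score c1, @loc_score c2).
rewrite c1E in l1 ls1; rewrite c2E in l2 ls2.
rewrite /score /mass c1E c2E -(tot_local ls1 l2) -(tot_local l1 ls2).
rewrite -totD; apply: eq_tot => s G _ _.
rewrite (node_dist_prod _ _ _ _ vE cE).
have -> : log_parents v G = log_parents c1 G + log_parents c2 G.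
  rewrite /log_parents /scope vE -/(scope c1) -/(scope c2) c1E c2E.
  by rewrite -bigU//; apply: eq_bigl => i; rewrite !inE.
have := node_dist_ge0 c1 (take #|S21| s) G w0.
have := node_dist_ge0 c2 (drop #|S21| s) G w0.
set q1 := node_dist w L c1 _ _; set q2 := node_dist w L c2 _ _.
(* If a factor vanishes, both sides are 0; otherwise the logarithm of the product splits. *)
rewrite !le0r => /orP[/eqP ->|q20] /orP[/eqP ->|q10]; try by ring.
by rewrite lnM ?posrE//; ring.
Qed.

End ProductNode.

(** All children have first parts of the same size, so the first half of [s] determines [S21], and
    its complement in [S2] is [S22]. Since the ordered pairs are distinct, the word determines the
    child. *)
Lemma sum_children_disjoint w v S1 S2 s (G : digraph d) (e e' : arrow) :
  lab v = Sum S1 S2 -> src e = v -> src e' = v ->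
  node_dist w L (tgt e) s G != 0 -> node_dist w L (tgt e') s G != 0 -> e = e'.
Proof.
move=> vE ev ev' qe qe'.
have partsE (a : arrow) : src a = v -> node_dist w L (tgt a) s G != 0 ->
    parts (tgt a) = ([set j in take (#|S2|./2) s]%SET,
                     S2 :\: [set j in take (#|S2|./2) s]%SET).
  move=> av; have va : edge v (tgt a) by rewrite -av edge_arrow.
  have [S21 [S22 [cP S2E dS cS]]] := sum_childP vE va.
  have := nodeP (tgt a); case=> [? ? H|? ? H|T1 T21 T22 c1 c2 aE cE _ [_ c1E] _];
    try by rewrite cP in H.
  move: aE; rewrite cP => -[eT1 eT21 eT22].
  rewrite (node_dist_prod _ _ _ _ cP cE) mulf_eq0 negb_or => /andP[q1 _].
  have [_ m1 _] := node_dist_supp (pos := fun i A => 0 < pG i A) leaf_supp q1.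
  have S21E : S21 = [set j in take (#|S2|./2) s]%SET.
    by apply/setP => j; rewrite inE -cS m1 c1E eT21.
  rewrite /parts cP -S21E -S2E; congr pair.
  rewrite finset.setDUl finset.setDv finset.set0U.
  by apply/esym/finset.setDidPl; rewrite disjoint_sym.
have := partsE _ ev qe; rewrite -(partsE _ ev' qe').
case: e e' ev ev' {qe qe'} => [u k] [u' k']; rewrite /src /= => eu eu'.
subst u u'; rewrite /tgt /= => pp.
congr existT; apply: val_inj => /=; have [_ /uniqP U] := bN vE.
have := U (parts v) k k'; rewrite !inE size_map !ltn_ord !(nth_map v)//.
by apply.
Qed.

Lemma score_leaf w v S1 i : lab v = Leaf S1 i -> score w v = leaf_score v.
Proof.
move=> vE; rewrite (leaf_scoreE vE) -(tot_set1 i) /score /scope vE.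
apply: eq_tot => s G _ _; rewrite (node_dist_leaf _ _ _ _ vE).
rewrite /log_parents /scope vE big_set1.
by case: eqP => _; rewrite ?mul1r// !mul0r.
Qed.

(** Disjointness of the supports moves [a * (l - ln a)] inside the sum over children, where the
    logarithm of weight times child splits. *)
Lemma score_sum w v S1 S2 : positive_weights w -> lab v = Sum S1 S2 ->
  score w v = \sum_(e | src e == v) (edge_weight w e * score w (tgt e) -
    edge_weight w e * ln (edge_weight w e) * mass w (tgt e)).
Proof.
move=> w0 vE; rewrite /score /mass.
under [RHS]eq_bigr => e /eqP ev.
  have ve : edge v (tgt e) by rewrite -ev edge_arrow.
  rewrite (scope_child vE ve) -mulNr -!totZ -totD; over.
rewrite -tot_sum; apply: eq_tot => s G _ _; rewrite (node_dist_sum _ _ _ _ vE).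
rewrite (sum_at_most_one (g := fun a => a * (log_parents v G - ln a))); first last.
- move=> e e' /eqP ev /eqP ev'.
  rewrite !mulf_eq0 !negb_or => /andP[_ qe] /andP[_ qe'].
  exact: sum_children_disjoint vE ev ev' qe qe'.
- by rewrite mul0r.
apply: eq_bigr => e /eqP ev.
have ve : edge v (tgt e) by rewrite -ev edge_arrow.
have -> : log_parents (tgt e) G = log_parents v G.
  by rewrite /log_parents (scope_child vE ve).
have := node_dist_ge0 (tgt e) s G w0; have := edge_weight_gt0 e w0.
move: (edge_weight w e) (node_dist w L (tgt e) s G) => a b a0.
rewrite le0r => /orP[/eqP ->|b0]; first by ring.
by rewrite lnM ?posrE//; ring.
Qed.

(** On the support the graph respects the order, so the indicator is 1 and the logarithm of [ptilde]
    is a sum over variables; elsewhere both sides contribute 0. Weights need not be normalized,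
    since partial derivatives leave the simplex. *)
Lemma elbo_score w : positive_weights w ->
  elbo pG L w = (score w (Defs.root N))%:E.
Proof.
move=> w0; have [_ /assocP[rC rS] _] := oN.
have supp x : spn_dist w L x != 0 -> models x.2 x.1 /\ forall i, 0 < pG i (x.2 i).
  move=> /(node_dist_supp (pos := fun i A => 0 < pG i A) leaf_supp)[_ _].
  rewrite rC rS => H; split=> [|i]; last by have [] := H i; rewrite ?inE.
  apply/forallP => i; have [+ _] := H i (finset.in_setT _).
  move=> /fintype.subsetP s; apply/fintype.subsetP => j /s; rewrite !inE /=.
  (* Positions in the listing of a permutation are the values of its inverse, which is how [before]
     compares variables. *)
  have idx k : index k [seq x.1 k | k <- enum 'I_d] = (x.1^-1)%g k :> nat.
    by rewrite -{1}(permKV x.1 k) index_map ?index_enum_ord//; exact: perm_inj.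
  by rewrite !idx.
have ptE x : spn_dist w L x != 0 -> ptilde pG x = \prod_i pG i (x.2 i).
  by move=> /supp[m _]; rewrite /ptilde m mulr1.
rewrite /elbo mean_lneD_entropy; first last.
- by move=> x qx; rewrite ptE// prodr_gt0// => i _; have [_] := supp _ qx.
- by move=> x; exact: node_dist_ge0.
congr EFin; rewrite /score rS -tot_setT; last first.
  move=> s G us; have [->|] := eqVneq (node_dist w L (Defs.root N) s G) 0.
    by rewrite mul0r.
  move=> /(node_dist_supp (pos := fun i A => 0 < pG i A) leaf_supp)[us' _ _].
  by rewrite us' in us.
apply: eq_bigr => x _; rewrite -/(spn_dist w L x).
have [->|qx] := eqVneq (spn_dist w L x) 0; first by rewrite !mul0r.
rewrite ptE// ln_prod => [|i _]; last by have [_] := supp _ qx.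
congr (_ * (_ - _)); rewrite /log_parents rS; apply: eq_bigl => i.
by rewrite inE.
Qed.

(** * Reverse-mode differentiation *)

Section Adjoint.
Variables (alpha beta b c : arrow -> R) (tE tZ aE aZ : node N -> R).

(* Reverse-mode differentiation: summing [a v * t v] over the nodes in two ways
   moves the recursion from the tangents [t] to the adjoints [a]. *)
Lemma adjoint_sum :
  (forall v, tE v = \sum_(e | src e == v)
     (alpha e * tE (tgt e) + beta e * tZ (tgt e) + b e)) ->
  (forall v, tZ v = \sum_(e | src e == v) (alpha e * tZ (tgt e) + c e)) ->
  (forall v, aE v = (v == Defs.root N)%:R +
     \sum_(e | tgt e == v) alpha e * aE (src e)) ->
  (forall v, aZ v = \sum_(e | tgt e == v)
     (alpha e * aZ (src e) + beta e * aE (src e))) ->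
  tE (Defs.root N) = \sum_e (aE (src e) * b e + aZ (src e) * c e).
Proof.
move=> tEE tZE aEE aZE.
have by_src a (f : arrow -> R) : \sum_v a v * \sum_(e | src e == v) f e =
    \sum_e a (src e) * f e.
  rewrite [RHS](partition_big src xpredT) //=; apply: eq_bigr => v _.
  by rewrite mulr_sumr; apply: eq_bigr => e /eqP ->.
have by_tgt t (f : arrow -> R) : \sum_v (\sum_(e | tgt e == v) f e) * t v =
    \sum_e f e * t (tgt e).
  rewrite [RHS](partition_big tgt xpredT) //=; apply: eq_bigr => v _.
  by rewrite mulr_suml; apply: eq_bigr => e /eqP ->.
have SE : tE (Defs.root N) + \sum_e alpha e * aE (src e) * tE (tgt e) =
    \sum_e aE (src e) * (alpha e * tE (tgt e) + beta e * tZ (tgt e) + b e).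
  rewrite -by_src -by_tgt -[tE (Defs.root N)]mul1r.
  transitivity (\sum_v aE v * tE v); last first.
    by apply: eq_bigr => v _; rewrite {1}tEE.
  under [RHS]eq_bigr do rewrite aEE mulrDl.
  rewrite big_split /=; congr (_ + _).
  rewrite (bigD1 (Defs.root N)) //= eqxx big1 ?addr0// => v /negPf ->.
  by rewrite mul0r.
have SZ : \sum_e (alpha e * aZ (src e) + beta e * aE (src e)) * tZ (tgt e) =
    \sum_e aZ (src e) * (alpha e * tZ (tgt e) + c e).
  rewrite -by_src -by_tgt; apply: eq_bigr => v _.
  by rewrite -aZE -tZE.
apply/eqP; rewrite -subr_eq0; apply/eqP.
(* The difference of the two sides is the sum of the defects of [SE] and [SZ]; the [beta] terms
   cancel between them. *)
transitivity ((tE (Defs.root N) + \sum_e alpha e * aE (src e) * tE (tgt e) -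
  \sum_e aE (src e) * (alpha e * tE (tgt e) + beta e * tZ (tgt e) + b e)) +
  (\sum_e (alpha e * aZ (src e) + beta e * aE (src e)) * tZ (tgt e) -
  \sum_e aZ (src e) * (alpha e * tZ (tgt e) + c e))).
  rewrite -!addrA; congr (_ + _); rewrite -!sumrN -!big_split /=.
  by apply: eq_bigr => e _; ring.
by rewrite SE SZ !subrr addr0.
Qed.

End Adjoint.

(** * Tangent recursions at normalized weights and the gradient *)

Section Gradient.
Variable phi : 'rV[R]_#|param N|.
Hypothesis phiW : is_weights phi.

Local Notation alpha := (edge_weight phi).
Local Notation E := (score phi).

Lemma phi_gt0 : positive_weights phi. Proof. by have [] := phiW. Qed.

Lemma arrow_leaf v (e : arrow) : children v = [::] -> src e <> v.
Proof. by move=> cv; case: e => u [k +]; rewrite /src /= => + uv; rewrite uv cv. Qed.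

Lemma sum_tgt (V : nmodType) (f : node N -> V) v :
  \sum_(e | src e == v) f (tgt e) = \sum_(c <- children v) f c.
Proof. by rewrite sum_src (big_nth v) big_mkord. Qed.

Lemma edge_weight1 w (e : arrow) : ~~ is_sum (src e) -> edge_weight w e = 1.
Proof.
move=> ns; rewrite /edge_weight insubF//.
by rewrite /arity -/(src e) (negPf ns) ltn0.
Qed.

Lemma sum_edge_weight v : is_sum v -> \sum_(e | src e == v) alpha e = 1.
Proof.
move=> vS; have [_ /(_ v vS) <-] := phiW; rewrite sum_src.
have aE : arity v = size (children v) by rewrite /arity vS.
rewrite (reindex (cast_ord aE)) /=; last first.
  by exists (cast_ord (esym aE)) => k _; rewrite ?cast_ordK ?cast_ordKV.
by apply: eq_bigr => k _; rewrite /edge_weight /= (valK k).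
Qed.

Lemma mass1 v : mass phi v = 1.
Proof.
elim/node_ind_down: v => v IH.
case: (nodeP v) => [S1 i vE _|S1 S2 vE|S1 S21 S22 c1 c2 vE cE dS [_ c1E] [_ c2E]].
- exact: mass_leaf vE.
- rewrite (mass_sum _ vE) -(@sum_edge_weight v) ?/is_sum ?vE//.
  apply: eq_bigr => e /eqP ev; rewrite IH ?mulr1// -ev; exact: edge_arrow.
- rewrite (mass_prod _ vE cE dS c1E c2E) !IH ?mulr1// /edge cE !inE eqxx ?orbT//.
Qed.

Lemma leaf_score0 v : ~~ is_leaf v -> leaf_score v = 0.
Proof. by rewrite /is_leaf /leaf_score /leaf_quantity; case: (lab v). Qed.

(** One formula serves all node kinds: [leaf_score] is 0 off the leaves, leaves have no outgoing
    edges, and edges out of product nodes have weight 1, with logarithm 0. *)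
Lemma score_rec v : E v = leaf_score v +
  \sum_(e | src e == v) (alpha e * E (tgt e) - alpha e * ln (alpha e)).
Proof.
have w0 := phi_gt0.
case: (nodeP v) => [S1 i vE cE|S1 S2 vE|S1 S21 S22 c1 c2 vE cE dS [_ c1E] [_ c2E]].
- rewrite (score_leaf _ vE) big1 ?addr0// => e /eqP ev.
  by have := arrow_leaf cE ev.
- rewrite (score_sum w0 vE) leaf_score0 ?/is_leaf ?vE// add0r.
  by apply: eq_bigr => e _; rewrite mass1 mulr1.
- rewrite (score_prod vE cE dS c1E c2E w0) !mass1 mulr1 mul1r.
  rewrite leaf_score0 ?/is_leaf ?vE// add0r.
  rewrite (eq_bigr (fun e => E (tgt e))) => [|e /eqP ev].
    by rewrite sum_tgt cE big_cons big_seq1.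
  by rewrite edge_weight1 ?ev /is_sum ?vE// ln1 mulr0 subr0 mul1r.
Qed.

Definition edge_dweight (e : arrow) (h : 'rV[R]_#|param N|) : R :=
  if insub (val (tagged e)) is Some k
  then weight h (existT (fun u => 'I_(arity u)) (tag e) k) else 0.

Lemma edge_dweight0 (e : arrow) h : ~~ is_sum (src e) -> edge_dweight e h = 0.
Proof.
move=> ns; rewrite /edge_dweight insubF//.
by rewrite /arity -/(src e) (negPf ns) ltn0.
Qed.

Lemma is_diff_edge_weight e :
  is_diff phi (fun w => edge_weight w e) (edge_dweight e).
Proof.
rewrite /edge_weight /edge_dweight; case: insubP => [k _ _|_]; last first.
  exact: is_diff_cst.
rewrite /weight; set j := enum_rank _.
pose f (w : 'rV[R]_#|param N|) := w ord0 j.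
have f_lin : linear f by move=> a u w; rewrite /f !mxE.
pose fM := GRing.isLinear.Build _ _ _ _ _ f_lin.
pose fL : {linear _ -> _} := HB.pack f fM.
apply: DiffDef; first exact: differentiable_coord.
by apply: (diff_lin (f := fL)); exact: coord_continuous.
Qed.

(* The partial derivative at phi of the score of src e in the mass of tgt e. *)
Definition cross (e : arrow) : R :=
  if is_sum (src e) then - (alpha e * ln (alpha e)) else E (src e) - E (tgt e).

Lemma near_positive : \forall w \near phi, positive_weights w.
Proof.
apply: (@filter_forall _ (param N) (fun e w => 0 < weight w e) _
  (nbhs_filter phi)) => e.
have c : {for phi,
    continuous (fun w : 'rV[R]_#|param N| => w ord0 (enum_rank e))}.
  exact: coord_continuous.
exact: (cvgr_gt _ c _ (phi_gt0 e)).
Qed.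

Section Tangents.
Variables dZ dE : node N -> 'rV[R]_#|param N| -> R.

Lemma is_diff_mass v :
  (forall c, edge v c -> is_diff phi (mass^~ c) (dZ c)) ->
  is_diff phi (mass^~ v) (fun h =>
    \sum_(e | src e == v) (alpha e * dZ (tgt e) h + edge_dweight e h)).
Proof.
move=> Hc.
case: (nodeP v) => [S1 i vE cE|S1 S2 vE|S1 S21 S22 c1 c2 vE cE dS [_ c1E] [_ c2E]].
- have -> : mass^~ v = cst 1 by apply/funext => w; rewrite (mass_leaf _ vE).
  apply: is_diff_eq; apply/funext => h; rewrite big1// => e /eqP ev.
  by have := arrow_leaf cE ev.
- have -> : mass^~ v = fun w => \sum_(e | src e == v)
      edge_weight w e * mass w (tgt e).
    by apply/funext => w; rewrite (mass_sum _ vE).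
  apply: is_diff_sum => e /eqP ev.
  have := Hc (tgt e); rewrite -ev => /(_ (edge_arrow e)) ze.
  have := is_diffM (is_diff_edge_weight e) ze => H.
  apply: is_diff_eq H _; apply/funext => h.
  by rewrite !fctE mass1 /GRing.scale /= mul1r.
- have -> : mass^~ v = (mass^~ c1) * (mass^~ c2).
    by apply/funext => w; rewrite (mass_prod _ vE cE dS c1E c2E).
  have [e1 e2] : edge v c1 /\ edge v c2 by rewrite /edge cE !inE !eqxx orbT.
  have := is_diffM (Hc _ e1) (Hc _ e2) => H.
  apply: is_diff_eq H _; apply/funext => h.
  rewrite (eq_bigr (fun e => dZ (tgt e) h)) => [|e /eqP ev]; last first.
    have ns : ~~ is_sum (src e) by rewrite ev /is_sum vE.
    by rewrite edge_weight1// edge_dweight0// mul1r addr0.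
  rewrite (sum_tgt (fun c => dZ c h)) cE big_cons big_seq1.
  by rewrite !fctE !mass1 /GRing.scale /= !mul1r addrC.
Qed.

(** The factor of [edge_dweight] is the derivative of [a * E - a * ln a] in the weight [a], at mass
    1. The recursions hold only for positive weights, hence the passage through [near_positive]. *)
Lemma is_diff_score v :
  (forall c, edge v c -> is_diff phi (mass^~ c) (dZ c)) ->
  (forall c, edge v c -> is_diff phi (score^~ c) (dE c)) ->
  is_diff phi (score^~ v) (fun h => \sum_(e | src e == v)
    (alpha e * dE (tgt e) h + cross e * dZ (tgt e) h +
     edge_dweight e h * (E (tgt e) - ln (alpha e) - 1))).
Proof.
move=> HZ HE.
case: (nodeP v) => [S1 i vE cE|S1 S2 vE|S1 S21 S22 c1 c2 vE cE dS [_ c1E] [_ c2E]].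
- have -> : score^~ v = cst (leaf_score v).
    by apply/funext => w; rewrite (score_leaf _ vE).
  apply: is_diff_eq; apply/funext => h; rewrite big1// => e /eqP ev.
  by have := arrow_leaf cE ev.
- apply: (@is_diff_near _ _ (fun w => \sum_(e | src e == v)
    (edge_weight w e * score w (tgt e) -
     edge_weight w e * ln (edge_weight w e) * mass w (tgt e)))).
    by apply: filterS near_positive => w w0; rewrite (score_sum w0 vE).
  apply: is_diff_sum => e /eqP ev.
  have := HE (tgt e); rewrite -ev => /(_ (edge_arrow e)) he.
  have := HZ (tgt e); rewrite -ev => /(_ (edge_arrow e)) hz.
  have ha := is_diff_edge_weight e.
  have a0 := edge_weight_gt0 e phi_gt0.
  have hl := is_diff_ln a0 ha.
  have H := is_diffB (is_diffM ha he) (is_diffM (is_diffM ha hl) hz).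
  apply: is_diff_eq H _; apply/funext => h.
  rewrite !fctE mass1 /GRing.scale /= /cross /is_sum ev vE.
  by field; rewrite gt_eqF.
- apply: (@is_diff_near _ _
    ((score^~ c1) * (mass^~ c2) + (mass^~ c1) * (score^~ c2))).
    apply: filterS near_positive => w w0.
    by rewrite (score_prod vE cE dS c1E c2E w0).
  have [e1 e2] : edge v c1 /\ edge v c2 by rewrite /edge cE !inE !eqxx orbT.
  have H := is_diffD (is_diffM (HE _ e1) (HZ _ e2))
    (is_diffM (HZ _ e1) (HE _ e2)).
  apply: is_diff_eq H _; apply/funext => h.
  (* At masses 1 the score of the sibling is [E v - E (tgt e)], so each edge contributes without
     reference to the other child. *)
  rewrite (eq_bigr (fun e => dE (tgt e) h + (E v - E (tgt e)) * dZ (tgt e) h))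
    => [|e /eqP ev]; last first.
    have ns : ~~ is_sum (src e) by rewrite ev /is_sum vE.
    by rewrite edge_weight1// edge_dweight0// /cross (negPf ns) ev; ring.
  rewrite (sum_tgt (fun c => dE c h + (E v - E c) * dZ c h)) cE big_cons big_seq1.
  rewrite (score_prod vE cE dS c1E c2E phi_gt0).
  by rewrite !fctE !mass1 /GRing.scale /=; ring.
Qed.

End Tangents.

Lemma differentiable_mass v : differentiable (mass^~ v) phi.
Proof.
elim/node_ind_down: v => v IH.
by have [] := is_diff_mass (dZ := fun c => 'd (mass^~ c) phi)
  (fun c vc => differentiableP (IH c vc)).
Qed.

Lemma differentiable_score v : differentiable (score^~ v) phi.
Proof.
elim/node_ind_down: v => v IH.
by have [] := is_diff_score (dZ := fun c => 'd (mass^~ c) phi)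
  (dE := fun c => 'd (score^~ c) phi)
  (fun c _ => differentiableP (differentiable_mass c))
  (fun c vc => differentiableP (IH c vc)).
Qed.

Lemma arity_children v : (arity v <= size (children v))%N.
Proof. by rewrite /arity; case: ifP. Qed.

Definition param_arrow (p : param N) : arrow :=
  existT (fun u => 'I_(size (children u))) (tag p)
    (widen_ord (arity_children (tag p)) (tagged p)).

Lemma edge_dweight_delta (p : param N) e :
  edge_dweight e (delta_mx ord0 (enum_rank p)) = (e == param_arrow p)%:R.
Proof.
rewrite /edge_dweight; case: insubP => [k _ ke|nk].
  rewrite /weight mxE eqxx /= (inj_eq enum_rank_inj); congr (_%:R).
  congr nat_of_bool; apply/eqP/eqP => [<-|ep].
    by case: e k ke => u k k' /= kk; congr existT; apply: val_inj; rewrite /= kk.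
  case: p ep => u l ep; subst e; rewrite /= in k ke *.
  by congr existT; apply: val_inj; rewrite /= ke.
case: eqP => // ep; subst e; case: p nk => u l /=.
by rewrite ltn_ord.
Qed.

(** Along a basis vector [edge_dweight] is nonzero on a single edge, so [adjoint_sum] collapses to
    the term of that edge. *)
Lemma elbo_gradient (aE aZ : node N -> R) :
  (forall v, aE v = (v == Defs.root N)%:R +
     \sum_(e | tgt e == v) alpha e * aE (src e)) ->
  (forall v, aZ v = \sum_(e | tgt e == v)
     (alpha e * aZ (src e) + cross e * aE (src e))) ->
  differentiable (fun w => fine (elbo pG L w)) phi /\
  forall p : param N, let e := param_arrow p in
    'D_(delta_mx ord0 (enum_rank p)) (fun w => fine (elbo pG L w)) phi =
    aE (src e) * (E (tgt e) - (ln (alpha e) + 1)) + aZ (src e).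
Proof.
move=> aEE aZE; have dZ c := differentiableP (differentiable_mass c).
have dE c := differentiableP (differentiable_score c).
(* The bound and the root score agree only at positive weights, that is, near [phi]. *)
have [df dfE] : is_diff phi (fun w => fine (elbo pG L w))
    ('d (score^~ (Defs.root N)) phi).
  apply: is_diff_near (dE (Defs.root N)).
  by apply: filterS near_positive => w /elbo_score ->.
split=> // p e; rewrite deriveE// dfE; set h := delta_mx _ _.
rewrite (adjoint_sum (tE := fun v => 'd (score^~ v) phi h)
  (tZ := fun v => 'd (mass^~ v) phi h) (alpha := alpha) (beta := cross)
  (b := fun e => edge_dweight e h * (E (tgt e) - ln (alpha e) - 1))
  (c := fun e => edge_dweight e h) _ _ aEE aZE).
- rewrite (bigD1 e)//= big1 ?addr0 => [|e' /negPf ee'].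
    by rewrite edge_dweight_delta eqxx mul1r mulr1 opprD addrA.
  by rewrite edge_dweight_delta ee' mul0r !mulr0 addr0.
- move=> v; have [_ sE] := is_diff_score (v := v)
    (dZ := fun c => 'd (mass^~ c) phi) (dE := fun c => 'd (score^~ c) phi)
    (fun c _ => dZ c) (fun c _ => dE c).
  by rewrite sE.
- move=> v; have [_ sE] := is_diff_mass (v := v)
    (dZ := fun c => 'd (mass^~ c) phi) (fun c _ => dZ c).
  by rewrite sE.
Qed.

End Gradient.


End Scores.

(** * The program *)

Section Program.
Local Open Scope classical_set_scope.

(** An environment gathers the parent functions, leaf distributions and weights that a single
    program must serve uniformly. *)
Let env : Type := (('I_d -> {set 'I_d} -> R) * (node N -> {set 'I_d} -> R) *
  'rV[R]_#|param N|)%type.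

Let valid : set env := fun x => [/\ forall i A, 0 <= x.1.1 i A, leaf_dists x.1.2,
  forall v, is_leaf v -> leaf_quantity x.1.1 x.1.2 v \is a fin_num &
  is_weights x.2].

Let inp (x : env) := inputs x.1.1 x.1.2 x.2.

Local Notation computable := (computable inp valid).

Lemma sum_card_fiber (f : arrow -> node N) :
  (\sum_v #|[pred e | f e == v]| = spn_size N)%N.
Proof.
rewrite -card_arrow -sum1_card [RHS](partition_big f xpredT) //=.
by apply: eq_bigr => v _; rewrite -sum1_card.
Qed.

(** Every node other than the root ends a nonempty path and so has an incoming edge. This converts a
    cost per node into a cost per edge. *)
Lemma card_node_le : (#|node N| <= (spn_size N).+1)%N.
Proof.
rewrite -(sum_card_fiber tgt) -sum1_card (bigD1 (Defs.root N)) //= add1n ltnS.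
rewrite [leqRHS](bigD1 (Defs.root N)) //=; apply: leq_trans (leq_addl _ _).
apply: leq_sum => v vr; apply/card_gt0P.
have [[/(_ v) /connectP[p rp vE] _] _ _] := oN.
case/lastP: p rp vE => [_ /= vE|p u]; first by rewrite vE eqxx in vr.
rewrite rcons_path last_rcons => /andP[_ e] ->.
set w := last _ _ in e.
have kw : (index u (children w) < size (children w))%N by rewrite index_mem.
exists (existT (fun u => 'I_(size (children u))) w (Ordinal kw)).
by rewrite inE /tgt /= nth_index.
Qed.

Lemma exists_program : is_sum (Defs.root N) ->
  exists (P : program (input_addr N)) (out_elbo : nat)
         (out_grad : param N -> nat),
    (size P <= 21 * spn_size N)%N /\
    forall x, valid x -> exists mem : seq R,
      [/\ run (inp x) P [::] = Some mem,
          exists2 y, onth mem out_elbo = Some y & elbo x.1.1 x.1.2 x.2 = y%:E,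
          differentiable (fun w => fine (elbo x.1.1 x.1.2 w)) x.2 &
          forall e : param N, onth mem (out_grad e) =
            Some ('D_(delta_mx ord0 (enum_rank e))
                    (fun w => fine (elbo x.1.1 x.1.2 w)) x.2)].
Proof.
move=> root_sum.
pose al (e : arrow) (x : env) : R := edge_weight x.2 e.
pose ll (e : arrow) x := ln (al e x).
pose ent (e : arrow) x := al e x * ll e x.
pose sc v (x : env) : R := score x.1.1 x.1.2 x.2 v.
pose cr (e : arrow) (x : env) : R := cross x.1.1 x.1.2 x.2 e.
(* aE and aZ are the adjoints of the score and of the mass. *)
have [aE aEE] := @rank_recursion (node N) (env -> R) (fun=> 0) layer
  (fun f v x => (v == Defs.root N)%:R +
     \sum_(e | tgt e == v) al e x * f (src e) x)
  ltac:(move=> f g v fg; apply/funext => x; congr (_ + _);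
    apply: eq_bigr => e /eqP ev; rewrite fg// -ev (layer_edge (edge_arrow e));
    exact: ltnSn).
have [aZ aZE] := @rank_recursion (node N) (env -> R) (fun=> 0) layer
  (fun f v x => \sum_(e | tgt e == v)
     (al e x * f (src e) x + cr e x * aE (src e) x))
  ltac:(move=> f g v fg; apply/funext => x;
    apply: eq_bigr => e /eqP ev; rewrite fg// -ev (layer_edge (edge_arrow e));
    exact: ltnSn).
(* The gradient formula is evaluated on all edges; a parameter reads its own through
   [param_arrow]. *)
pose gr (e : arrow) x :=
  aE (src e) x * (sc (tgt e) x - (ll e x + 1)) + aZ (src e) x.
have [A0 [z0 o0 c0]] : exists A : set (env -> R),
    [/\ A (fun=> 0), A (fun=> 1) & computable 2 A].
  eexists; split; last first.
  - apply: (computable_const (z := 1%Z) (f := fun=> 1)); last by [].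
    apply: (computable_const (z := 0%Z) (f := fun=> 0)); last by [].
    exact: computable0.
  - by left.
  - by right; left.
(* With constant rank 0 the condition on smaller ranks is vacuous, so edges are treated in any
   order. *)
have al_step e m B : A0 `<=` B -> (forall u : arrow, (0 < 0)%N -> B (al u)) ->
    computable m B -> computable (m + 1) (al e |` B).
  move=> _ _ cB; rewrite addn1.
  case: (insubP 'I_(arity (tag e)) (val (tagged e))) => [k _ ke|nk].
    pose p : param N := existT (fun u => 'I_(arity u)) (tag e) k.
    apply: (computable_input (i := inl p) cB) => x _.
    by rewrite /al /edge_weight -ke valK.
  apply: (computable_const (z := 1%Z) cB) => x _.
  by rewrite /al /edge_weight insubN.
have [A1 [s1 al1 c1]] := computable_rank al_step c0.
have ll_step e m B : A1 `<=` B -> (forall u : arrow, (0 < 0)%N -> B (ll u)) ->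
    computable m B -> computable (m + 1) (ll e |` B).
  move=> sB _ cB; rewrite addn1.
  apply: (computable_ln (f := al e) cB) => //; first exact: sB.
  by move=> x [_ _ _ [w0 _]]; exact: edge_weight_gt0.
have [A2 [s2 ll2 c2]] := computable_rank ll_step c1.
have ent_step e m B : A2 `<=` B -> (forall u : arrow, (0 < 0)%N -> B (ent u)) ->
    computable m B -> computable (m + 1) (ent e |` B).
  move=> sB _ cB; rewrite addn1.
  apply: (computable_mul (f := al e) (g := ll e) cB) => //; last exact: sB.
  exact/sB/s2.
have [A3 [s3 ent3 c3]] := computable_rank ent_step c2.
(* Upward pass: ranking by [#|node N| - layer] puts children before parents. An edge costs a
   product, a subtraction and an accumulation; the extra 1 loads the initial value. *)
have sc_step v m B : A3 `<=` B ->
    (forall u, (#|node N| - layer u < #|node N| - layer v)%N -> B (sc u)) ->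
    computable m B ->
    computable (m + (#|[pred e | src e == v]| * 3 + 1)) (sc v |` B).
  move=> sB scB cB; pose b (x : env) := leaf_score x.1.1 x.1.2 v.
  have cb : computable m.+1 (b |` B).
    case: (boolP (is_leaf v)) => vl.
      exact: (computable_input (i := inr (exist _ v vl)) cB).
    by apply: (computable_const (z := 0%Z) cB) => x _; rewrite /b leaf_score0.
  rewrite addn1 addnS -addSn.
  apply: computable_mono (leqnn _) _ (computable_sum (k := 2%N) (b := b)
    (Q := [pred e | src e == v]) (t := fun e x => al e x * sc (tgt e) x - ent e x)
    (f := sc v) _ cb _ _).
  - by move=> f [->|Bf]; [left|right; right].
  - move=> e m' B' /= /eqP ev sB' cB'; rewrite addn2.
    have Bal : B' (al e) by apply/sB'; right; exact/sB/s3/s2/al1.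
    have Bent : B' (ent e) by apply/sB'; right; exact/sB/ent3.
    have Bsc : B' (sc (tgt e)).
      apply/sB'; right; apply: scB; have := layer_lt_card (tgt e).
      by rewrite (layer_edge (edge_arrow e)) ev; lia.
    pose p x := al e x * sc (tgt e) x.
    have cp : computable m'.+1 (p |` B') by exact: computable_mul cB' Bal Bsc _.
    apply: computable_mono (leqnn _) _
      (computable_sub (f := p) (g := ent e) cp _ _ _) => //.
    + by move=> f [->|Bf]; [left|right; right].
    + by left.
    + by right.
  - by left.
  - by move=> x [pG0 Ld Lf W]; exact: score_rec.
have [A4 [s4 sc4 c4]] := computable_rank sc_step c3.
have cr_step e m B : A4 `<=` B -> (forall u : arrow, (0 < 0)%N -> B (cr u)) ->
    computable m B -> computable (m + 1) (cr e |` B).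
  move=> sB _ cB; rewrite addn1.
  case: (boolP (is_sum (src e))) => ve.
    apply: (computable_sub (f := fun=> 0) (g := ent e) cB).
    - exact/sB/s4/s3/s2/s1/z0.
    - exact/sB/s4/ent3.
    - by move=> x _; rewrite sub0r /cr /cross ve.
  apply: (computable_sub (f := sc (src e)) (g := sc (tgt e)) cB).
  - exact/sB/sc4.
  - exact/sB/sc4.
  - by move=> x _; rewrite /cr /cross (negPf ve).
have [A5 [s5 cr5 c5]] := computable_rank cr_step c4.
(* Downward pass: the rank is the layer, so the sources of incoming edges come first. *)
have aE_step v m B : A5 `<=` B ->
    (forall u, (layer u < layer v)%N -> B (aE u)) -> computable m B ->
    computable (m + #|[pred e | tgt e == v]| * 2) (aE v |` B).
  move=> sB aB cB; pose b (x : env) : R := (v == Defs.root N)%:R.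
  apply: (computable_sum (k := 1%N) (b := b)
    (t := fun e x => al e x * aE (src e) x) _ cB) => /=.
  - move=> e m' B' /= /eqP ev sB' cB'; rewrite addn1.
    apply: (computable_mul (f := al e) (g := aE (src e)) cB') => //.
      exact/sB'/sB/s5/s4/s3/s2/al1.
    by apply/sB'/aB; rewrite -ev (layer_edge (edge_arrow e)).
  - rewrite /b; case: eqP => _; first exact/sB/s5/s4/s3/s2/s1/o0.
    exact/sB/s5/s4/s3/s2/s1/z0.
  - by move=> x _; rewrite aEE.
have [A6 [s6 aE6 c6]] := computable_rank aE_step c5.
(* Per edge: two products, their sum and an accumulation. *)
have aZ_step v m B : A6 `<=` B ->
    (forall u, (layer u < layer v)%N -> B (aZ u)) -> computable m B ->
    computable (m + #|[pred e | tgt e == v]| * 4) (aZ v |` B).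
  move=> sB aB cB.
  apply: (computable_sum (k := 3%N) (b := fun=> 0)
    (t := fun e x => al e x * aZ (src e) x + cr e x * aE (src e) x) _ cB) => /=.
  - move=> e m' B' /= /eqP ev sB' cB'; rewrite addn3.
    pose p x := al e x * aZ (src e) x; pose q x := cr e x * aE (src e) x.
    have cp : computable m'.+1 (p |` B').
      apply: (computable_mul (f := al e) (g := aZ (src e)) cB') => //.
        exact/sB'/sB/s6/s5/s4/s3/s2/al1.
      by apply/sB'/aB; rewrite -ev (layer_edge (edge_arrow e)).
    have cq : computable m'.+2 (q |` (p |` B')).
      apply: (computable_mul (f := cr e) (g := aE (src e)) cp) => //.
        by right; exact/sB'/sB/s6/cr5.
      by right; exact/sB'/sB/aE6.
    apply: computable_mono (leqnn _) _
      (computable_add (f := p) (g := q) cq _ _ _) => //.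
    + by move=> f [->|Bf]; [left|right; right; right].
    + by right; left.
    + by left.
  - exact/sB/s6/s5/s4/s3/s2/s1/z0.
  - by move=> x _; rewrite aZE add0r.
have [A7 [s7 aZ7 c7]] := computable_rank aZ_step c6.
have gr_step e m B : A7 `<=` B ->
    (forall u : arrow, (0 < 0)%N -> B (gr u)) -> computable m B ->
    computable (m + 4) (gr e |` B).
  move=> sB _ cB; rewrite addn4.
  pose p x := ll e x + 1; pose q x := sc (tgt e) x - p x.
  pose r x := aE (src e) x * q x.
  have cp : computable m.+1 (p |` B).
    apply: (computable_add (f := ll e) (g := fun=> 1) cB) => //.
      exact/sB/s7/s6/s5/s4/s3/ll2.
    exact/sB/s7/s6/s5/s4/s3/s2/s1/o0.
  have cq : computable m.+2 (q |` (p |` B)).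
    apply: (computable_sub (f := sc (tgt e)) (g := p) cp) => //; last by left.
    by right; exact/sB/s7/s6/s5/sc4.
  have cr' : computable m.+3 (r |` (q |` (p |` B))).
    apply: (computable_mul (f := aE (src e)) (g := q) cq) => //; last by left.
    by right; right; exact/sB/s7/aE6.
  apply: computable_mono (leqnn _) _
    (computable_add (f := r) (g := aZ (src e)) cr' _ _ _) => //.
  - by move=> f [->|Bf]; [left|do 4!right].
  - by left.
  - by right; right; right; exact/sB/aZ7.
have [A8 [s8 gr8 [P [sP rP AP]]]] := computable_rank gr_step c7.
have [oe oeP] := AP _ (s8 _ (s7 _ (s6 _ (s5 _ (sc4 (Defs.root N)))))).
have [og ogP] := choice (fun p : param N => AP _ (gr8 (param_arrow p))).
exists P, oe, og; split.
  (* In total 17 instructions per edge, one per node and two constants. There is at most one more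
     node than edges, and the root sum node has a child, so 18 per edge plus 3 is at most 21 per
     edge. *)
  apply: leq_trans sP _.
  have fib (f : arrow -> node N) k :
      (\sum_v #|[pred e : arrow | f e == v]| * k = spn_size N * k)%N.
    by rewrite -big_distrl /= sum_card_fiber.
  have n1 : (\sum_(v : node N) 1 <= (spn_size N).+1)%N.
    by rewrite sum_nat_const muln1; exact: card_node_le.
  rewrite big_split /= !fib; set k := (\sum_(v : node N) 1)%N in n1 *.
  rewrite !sum_nat_const card_arrow.
  have N1 : (0 < spn_size N)%N.
    have [_ _ /(_ (Defs.root N))] := oN; rewrite /local_wf; move: root_sum.
    rewrite /is_sum; case: (lab _) => // S1 S2 _ [_ _ c _].
    rewrite /spn_size (bigD1 (Defs.root N)) //= ltn_addr//.
    by case: (children _) c.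
  by move: k n1 => k n1; lia.
move=> x Vx; have [mem r] := rP x Vx; exists mem.
have [pG0 Ld Lf W] := Vx.
have [df gE] := elbo_gradient pG0 Ld Lf W (fun v => congr1 (fun f => f x) (aEE v))
  (fun v => congr1 (fun f => f x) (aZE v)).
split=> //.
  exists (sc (Defs.root N) x); first exact: stores_onth oeP Vx r.
  by apply: elbo_score => //; exact: phi_gt0.
by move=> p; rewrite (stores_onth (ogP p) Vx r) gE.
Qed.

End Program.
End Structure.

Theorem proposition5 (R : realType) :
  exists C : nat, forall (d : nat) (N : spn d),
    (2 <= d)%N -> regular_order_spn N ->
    exists (P : program (input_addr N)) (out_elbo : nat)
           (out_grad : param N -> nat),
      (size P <= C * spn_size N)%N /\
      forall (pG : 'I_d -> {set 'I_d} -> R) (p : {perm 'I_d} * digraph d -> R)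
             (L : node N -> {set 'I_d} -> R) (phi : 'rV[R]_#|param N|),
        order_modular pG p ->
        leaf_dists L ->
        (forall v, is_leaf v -> leaf_quantity pG L v \is a fin_num) ->
        is_weights phi ->
        exists mem : seq R,
          [/\ run (inputs pG L phi) P [::] = Some mem,
              exists2 y, onth mem out_elbo = Some y & elbo pG L phi = y%:E,
              differentiable (fun w => fine (elbo pG L w)) phi &
              forall e : param N,
                onth mem (out_grad e) =
                Some ('D_(delta_mx ord0 (enum_rank e))
                        (fun w => fine (elbo pG L w)) phi)].
Proof.
exists 21%N => d N _ [oN [layer [K [rs l0 le _]]] bN].
have [P [oe [og [sP PP]]]] := exists_program oN bN l0 le R rs.
exists P, oe, og; split=> // pG p L phi [_ pG0 _] Ld Lf W.
exact: (PP (pG, L, phi)).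
Qed.
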